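(* Let $X$ be an affine complex variety and let $f : X(\mathbb{C}) \to \mathbb{C}$ be a function. Then $f\in\mathcal{K}^0(X(\mathbb{C}))$ if and only if the following three properties hold: 1) $f$ is rational on $X(\mathbb{C})$; 2) $f$ is integral over $\mathbb{C}[X]$, i.e. there exists a monic polynomial $P(t)\in \mathbb{C}[X][t]$ such that $P(x,f(x))=0$ for all $x\in X(\mathbb{C})$; 3) the graph $\Gamma_f=\{(x,f(x))\mid x\in X(\mathbb{C})\}$ is Zariski closed in $X(\mathbb{C})\times\mathbb{A}^1(\mathbb{C})$.
   Context: An affine complex variety is $X=\operatorname{Spec}(\mathbb{C}[X])$ with $\mathbb{C}[X]$ a reduced finitely generated $\mathbb{C}$-algebra ($X$ need not be irreducible). $X(\mathbb{C})$ is the set of closed points of $X$, identified with a Zariski closed subset of some $\mathbb{C}^n$; elements of $\mathbb{C}[X]$ are identified with polynomial functions on $X(\mathbb{C})$. A function $f:X(\mathbb{C})\to\mathbb{C}$ is rational if it is regular on some Zariski dense Zariski open subset of $X(\mathbb{C})$. $\mathcal{K}^0(X(\mathbb{C}))$ is the ring of functions $f:X(\mathbb{C})\to\mathbb{C}$ that are rational and continuous on all of $X(\mathbb{C})$ for the Euclidean topology. For $P\in\mathbb{C}[X][t]$, $P(x,s)$ denotes the value at $s\in\mathbb{C}$ of the polynomial obtained by evaluating the coefficients of $P$ at $x$. *)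

(* Defs.v *)
From HB Require Import structures.
From mathcomp Require Import all_boot all_order all_algebra complex.
From mathcomp Require Import all_classical reals topology normedtype.
From mathcomp Require mpoly.

Set Implicit Arguments.
Unset Strict Implicit.
Unset Printing Implicit Defensive.

Import Order.TTheory GRing.Theory Num.Theory numFieldNormedType.Exports.
Local Open Scope classical_set_scope.
Local Open Scope ring_scope.

(* [R[i]] packed as a [numClosedFieldType], so that it, and the matrices over
   it, inherit the Euclidean topology that [numFieldNormedType] gives to any
   [numClosedFieldType]. *)
Definition Cplx (R : realType) : numClosedFieldType := R[i].

(* [mpoly] is not imported, because its notations clash with those of the
   analysis library; this is {mpoly C[n]}. *)
Definition polyring (R : realType) (n : nat) := mpoly.mpoly n (Cplx R).

Definition peval (R : realType) (n : nat) (p : polyring R n)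
    (x : 'rV[Cplx R]_n) : Cplx R :=
  mpoly.meval (fun i => x ord0 i) p.

Definition zeros (R : realType) (n : nat) (S : set (polyring R n)) :
    set 'rV[Cplx R]_n :=
  [set x | forall p, S p -> peval p x = 0].

(* The complex points of an affine variety: a Zariski closed subset of C^n,
   possibly empty or reducible. *)
Definition affine_variety (R : realType) (n : nat) (X : set 'rV[Cplx R]_n) :
    Prop :=
  exists S : set (polyring R n), X = zeros S.

(* The Zariski topology of [X], on subsets of the subtype of its points. *)
Definition zclosed (R : realType) (n : nat) (X : set 'rV[Cplx R]_n)
    (Z : set X) : Prop :=
  exists S : set (polyring R n), Z = [set x : X | zeros S (val x)].

Definition zopen (R : realType) (n : nat) (X : set 'rV[Cplx R]_n)
    (U : set X) : Prop :=
  zclosed (~` U).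

Definition zdense (R : realType) (n : nat) (X : set 'rV[Cplx R]_n)
    (U : set X) : Prop :=
  forall Z : set X, zclosed Z -> U `<=` Z -> Z = setT.

(* C[X], identified with the ring of polynomial functions on the points of X. *)
Definition coord_ring (R : realType) (n : nat) (X : set 'rV[Cplx R]_n) :
    set (X -> Cplx R) :=
  [set a | exists p : polyring R n, forall x : X, a x = peval p (val x)].
Arguments coord_ring {R n} X.

(* Regularity is local: near each point of [U], [f] is a quotient of two
   elements of C[X] with nonvanishing denominator. *)
Definition regular_on (R : realType) (n : nat) (X : set 'rV[Cplx R]_n)
    (U : set X) (f : X -> Cplx R) : Prop :=
  forall x, U x ->
    exists V : set X, [/\ zopen V, V x, V `<=` U &
      exists a b : X -> Cplx R, [/\ coord_ring X a, coord_ring X b &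
        forall y, V y -> b y != 0 /\ f y = a y / b y]].

Definition rational_fun (R : realType) (n : nat) (X : set 'rV[Cplx R]_n)
    (f : X -> Cplx R) : Prop :=
  exists U : set X, [/\ zopen U, zdense U & regular_on U f].

(* K^0(X(C)); [X] carries the topology induced by the Euclidean one on C^n. *)
Definition K0 (R : realType) (n : nat) (X : set 'rV[Cplx R]_n) :
    set (X -> Cplx R) :=
  [set f | rational_fun f /\ continuous f].
Arguments K0 {R n} X.

(* The monic polynomial P(t) = t^d + \sum_(i < d) a_i t^i in C[X][t] is given
   by its lower coefficients, since [{poly _}] requires a nonzero coefficient
   ring while C[X] is zero when X is empty. *)
Definition integral_fun (R : realType) (n : nat) (X : set 'rV[Cplx R]_n)
    (f : X -> Cplx R) : Prop :=
  exists (d : nat) (a : 'I_d -> X -> Cplx R),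
    (forall i, coord_ring X (a i)) /\
    forall x, f x ^+ d + \sum_(i < d) a i x * f x ^+ i = 0.

(* X(C) x A^1(C) as a subset of C^(n+1), the last coordinate being that of
   A^1. *)
Definition prodA1 (R : realType) (n : nat) (X : set 'rV[Cplx R]_n) :
    set 'rV[Cplx R]_(n + 1) :=
  [set v | X (lsubmx v)].

Definition graph_fun (R : realType) (n : nat) (X : set 'rV[Cplx R]_n)
    (f : X -> Cplx R) : set (prodA1 X) :=
  [set v | exists x : X, val v = row_mx (val x) (f x)%:M].

(* Main.v *)
(** The graph of [f] over a dense open set of regularity is locally closed in
    the Zariski topology, and so is { (x, 1 / f x) }.  Everything rests on the
    fact that a point in the Zariski closure of a locally closed set is a limit
    of points of that set for the Euclidean topology.  Applied to the graph, it
    shows that the Zariski closure adds no point to the graph of a continuous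
    [f].  Applied to { (x, s) | s = 1 / f x }, it shows that the closure of this
    set does not meet s = 0, for [f] would be unbounded near such a point; by
    the Nullstellensatz 1 = s H(x, s) on this set, and multiplying by a power
    of [f] gives an integral equation.  Conversely, near x0 the integral
    equation forces f x to be close to one of the roots of P(x0, t), and the
    closedness of the graph excludes the roots other than f x0.

    For the density fact, take a prime ideal which avoids the equation h of the
    boundary and is contained in the ideal of the given point z0, and let B be
    the quotient ring.  By Noether normalization B is integral over a polynomial ring
    A = C[y_1..y_r].  Choose t in B nonzero at z0 and zero at the other points
    of the fibre of z0 over A.  As A is integrally closed, t has a minimal
    polynomial that is monic over A and whose zeros are all specializations
    of (y, t); moving y generically along a line, a root of it stays close to
    t(z0), and any point of B above it has to be close to z0. *)
Require Import Defs.
From HB Require Import structures.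
From mathcomp Require Import all_boot all_order all_algebra.
From mathcomp Require mpoly boolp classical_sets.

Set Implicit Arguments.
Unset Strict Implicit.
Unset Printing Implicit Defensive.

(** * Prime ideals and Noetherian rings *)

Module Ideals.
Import boolp classical_sets.
Import GRing.Theory.
Local Open Scope ring_scope.

Definition is_ideal (A : comNzRingType) (I : A -> Prop) :=
  I 0 /\ forall a u v, I u -> I v -> I (a * u + v).

Section Ideal.
Variables (A : comNzRingType) (I : A -> Prop) (hI : is_ideal I).
Lemma ideal0 : I 0. Proof. by case: hI. Qed.
Lemma idealD u v : I u -> I v -> I (u + v).
Proof. by move=> hu hv; rewrite -[u]mul1r; case: hI => _; apply. Qed.
Lemma idealMl a u : I u -> I (a * u).
Proof. by move=> hu; rewrite -[_ * _]addr0; case: hI => h0; apply. Qed.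
Lemma idealB u v : I u -> I v -> I (u - v).
Proof. by move=> hu hv; apply: idealD => //; rewrite -mulN1r; apply: idealMl. Qed.
Lemma ideal_sum (J : Type) (r : seq J) (P : pred J) (F : J -> A) :
  (forall i, P i -> I (F i)) -> I (\sum_(i <- r | P i) F i).
Proof. by move=> h; elim/big_ind: _ => //; [exact: ideal0|exact: idealD]. Qed.
End Ideal.

Section Quotient.
Variables (A : comNzRingType) (I : A -> Prop) (hI : is_ideal I).
Hypothesis hI1 : ~ I 1.
Hypothesis hIp : forall x y, I (x * y) -> I x \/ I y.

Definition ideal_pred : {pred A} := fun x => asbool (I x).
Lemma ideal_pred_closed : idealr_closed ideal_pred.
Proof.
split; [exact/asboolP/(ideal0 hI)|exact/asboolP|].
by move=> a u v /asboolP hu /asboolP hv; apply/asboolP; case: hI => _; apply.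
Qed.
HB.instance Definition _ := isIdealr.Build A ideal_pred ideal_pred_closed.

Lemma prime_quotient : exists (B : comNzRingType) (p : {rmorphism A -> B}),
  (forall x y : B, x * y = 0 -> x = 0 \/ y = 0) /\ forall a, p a = 0 <-> I a.
Proof.
pose Q : comNzRingType := {ideal_quot ideal_pred}.
pose p : {rmorphism A -> Q} := \pi_Q%qT.
have pP a : p a = 0 <-> I a.
  rewrite -(rmorph0 p); split.
    by move/eqP; rewrite -Quotient.idealrBE subr0 => /asboolP.
  by move=> h; apply/eqP; rewrite -Quotient.idealrBE subr0; apply/asboolP.
exists Q, p; split=> // x y.
rewrite -[x]reprK -[y]reprK => xy.
have : I (repr x * repr y) by apply/pP; rewrite rmorphM.
by case/hIp => h; [left|right]; apply/pP.
Qed.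
End Quotient.

(** An ideal maximal among those that contain [J] and avoid [M] is prime, because [M] is
    multiplicative; [B] is the quotient by it. *)
Lemma separating_domain (A : comNzRingType) (J M : A -> Prop) :
  is_ideal J -> M 1 -> (forall x y, M x -> M y -> M (x * y)) -> (forall x, J x -> ~ M x) ->
  exists (B : comNzRingType) (p : {rmorphism A -> B}),
    [/\ forall x y : B, x * y = 0 -> x = 0 \/ y = 0, forall a, J a -> p a = 0
      & forall a, M a -> p a <> 0].
Proof.
move=> idJ M1 MM JM.
pose good (X : A -> Prop) := [/\ is_ideal X, forall a, J a -> X a & forall a, X a -> ~ M a].
have goodJ : good J by split.
have [F Fgood Ftot|P [Pgood Pmax]] := @Zorn_bigcup A (fun X => X = set0 \/ good X).
  have [[X0 FX0 goodX0]|no] := pselect (exists2 X, F X & good X); last first.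
    left; apply/seteqP; split=> // x [X FX Xx].
    by have [X0|gX] := Fgood X FX; [rewrite X0 in Xx|case: no; exists X].
  right; split; first split.
  - by exists X0 => //; case: goodX0 => /ideal0.
  - move=> a u v [X FX Xu] [Y FY Yv].
    have ex Z z : F Z -> Z z -> good Z.
      by move=> FZ Zz; have [Z0|//] := Fgood Z FZ; rewrite Z0 in Zz.
    have [XY|YX] := Ftot X Y FX FY.
      by exists Y => //; have [[_ h] _ _] := ex Y v FY Yv; apply: h => //; apply: XY.
    by exists X => //; have [[_ h] _ _] := ex X u FX Xu; apply: h => //; apply: YX.
  - by move=> a Ja; exists X0 => //; case: goodX0 => _ h _; apply: h.
  - move=> a [X FX Xa]; have [X0'|[_ _ h]] := Fgood X FX; first by rewrite X0' in Xa.
    exact: h.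
have {Pgood} goodP : good P.
  case: Pgood => // P0; case: (Pmax J); last by right.
  by rewrite P0; split=> // /(_ 0 (ideal0 idJ)).
have [idP JP PM] := goodP.
(* By maximality, the ideal generated by [P] and an element outside it meets [M]. *)
have meet x : ~ P x -> exists q a, P q /\ M (q + a * x).
  move=> Px; pose X (y : A) := exists q a, P q /\ y = q + a * x.
  have PX : (P `<=` X)%classic by move=> y Py; exists y, 0; rewrite mul0r addr0.
  have Xx : X x by exists 0, 1; rewrite mul1r add0r; split=> //; apply: ideal0.
  apply: contrapT => no; apply: (Pmax X).
    by split=> // /(_ x Xx).
  right; split.
  - split; first by exists 0, 0; rewrite mul0r addr0; split=> //; apply: ideal0.
    move=> a u v [q [b [Pq ->]]] [q' [b' [Pq' ->]]].
    exists (a * q + q'), (a * b + b'); split; first by case: idP => _; apply.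
    by rewrite mulrDr mulrDl mulrA addrACA.
  - by move=> a /JP/PX.
  - by move=> a [q [b [Pq ->]]] Ma; apply: no; exists q, b.
have [||B [p [dom pP]]] := @prime_quotient A P idP.
- by move=> /PM.
- move=> x y Pxy; apply: contrapT => /not_orP[/meet[q [a [Pq Mx]]] /meet[q' [a' [Pq' My]]]].
  apply: (PM _ _ (MM _ _ Mx My)).
  rewrite mulrDl; apply: idealD => //; first by rewrite mulrC; apply: idealMl.
  rewrite mulrDr; apply: idealD => //; first by apply: idealMl.
  by rewrite mulrACA; apply: idealMl.
exists B, p; split=> // a; first by move/JP/pP.
by move=> Ma /pP/PM.
Qed.

(** * Finite generation and Hilbert's basis theorem *)

Definition combination (A : comNzRingType) (s : seq A) (x : A) :=
  exists c : nat -> A, x = \sum_(i < size s) c i * s`_i.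

(** Stated for subsets, with generators taken in [S] itself: any system of equations contains a
    finite one generating the same ideal. *)
Definition noetherian (A : comNzRingType) := forall S : A -> Prop,
  exists s, (forall x, x \in s -> S x) /\ forall x, S x -> combination s x.

Lemma combination_ideal (A : comNzRingType) (s : seq A) : is_ideal (combination s).
Proof.
split; first by exists (fun _ => 0); rewrite big1 // => i _; rewrite mul0r.
move=> a u v [c ->] [d ->]; exists (fun i => a * c i + d i).
rewrite mulr_sumr -big_split /=; apply: eq_bigr => i _.
by rewrite mulrDl mulrA.
Qed.

Lemma combination_mem (A : comNzRingType) (s : seq A) x : x \in s -> combination s x.
Proof.
move=> xs; have lt : (index x s < size s)%N by rewrite index_mem.
exists (fun i => (i == index x s)%:R); rewrite (bigD1 (Ordinal lt)) //= eqxx mul1r nth_index //.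
rewrite big1 ?addr0 // => i /negPf; rewrite -val_eqE /= => ->.
exact: mul0r.
Qed.

Lemma combination_min (A : comNzRingType) (s : seq A) (I : A -> Prop) x :
  is_ideal I -> (forall y, y \in s -> I y) -> combination s x -> I x.
Proof.
move=> idI sI [c ->]; apply: ideal_sum => // i _; apply: idealMl => //.
by apply: sI; apply: mem_nth.
Qed.

Lemma noetherian_field (F : fieldType) : noetherian F.
Proof.
move=> S; have [[x [Sx x0]]|no] := pselect (exists x, S x /\ x <> 0).
  exists [:: x]; split=> [y|y _]; first by rewrite inE => /eqP ->.
  by exists (fun _ => y / x); rewrite big_ord1 /= divfK //; apply/eqP.
exists [::]; split=> // x Sx; have [->|/eqP x0] := eqVneq x 0; last by case: no; exists x.
exact: ideal0 (combination_ideal _).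
Qed.

Lemma noetherian_surj (A B : comNzRingType) (f : {rmorphism A -> B}) :
  (forall b, exists a, f a = b) -> noetherian A -> noetherian B.
Proof.
move=> sur nA S; have [s [sS sP]] := nA (fun a => S (f a)).
exists (map f s); split=> [_ /mapP[x /sS Sx ->]//|b Sb].
have [a ab] := sur b; have [|c e] := sP a; first by rewrite ab.
exists (f \o c); rewrite -ab e rmorph_sum size_map; apply: eq_bigr => i _.
by rewrite rmorphM (nth_map 0).
Qed.

(** Each generator of the ideal spanned by [S] involves finitely many elements of [S]; together
    these still generate. *)
Lemma noetherian_ideal_gen (A : comNzRingType) :
  (forall I : A -> Prop, is_ideal I ->
     exists s, (forall x, x \in s -> I x) /\ forall x, I x -> combination s x) ->
  noetherian A.
Proof.
move=> h S; pose I x := exists s, (forall y, y \in s -> S y) /\ combination s x.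
have monoC (s s' : seq A) x : {subset s <= s'} -> combination s x -> combination s' x.
  move=> ss' ; apply: combination_min; first exact: combination_ideal.
  by move=> y /ss'; apply: combination_mem.
have idI : is_ideal I.
  split; first by exists [::]; split=> //; apply: ideal0 (combination_ideal _).
  move=> a u v [s [sS su]] [s' [sS' sv]]; exists (s ++ s'); split.
    by move=> y; rewrite mem_cat => /orP[/sS|/sS'].
  have [_ hc] := combination_ideal (s ++ s'); apply: hc.
    by apply: monoC su => y ys; rewrite mem_cat ys.
  by apply: monoC sv => y ys; rewrite mem_cat ys orbT.
have [s [sI sP]] := h I idI.
have [s' [sS' ss']] : exists s', (forall y, y \in s' -> S y) /\ forall y, y \in s -> combination s' y.
  elim: s sI {sP} => [|x s IH] sI; first by exists [::].
  have [|s' [sS' ss']] := IH; first by move=> y ys; apply: sI; rewrite inE ys orbT.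
  have [|t [tS tx]] := sI x; first exact: mem_head.
  exists (t ++ s'); split=> y; first by rewrite mem_cat => /orP[/tS|/sS'].
  rewrite inE => /orP[/eqP ->|/ss'].
    by apply: monoC tx => z zt; rewrite mem_cat zt.
  by apply: monoC => z zs; rewrite mem_cat zs orbT.
exists s'; split=> // x Sx; apply: (combination_min (combination_ideal _) ss').
apply: sP; exists [:: x]; split=> [y|]; first by rewrite inE => /eqP ->.
by apply: combination_mem; rewrite mem_head.
Qed.

(** In an ideal that is not finitely generated, choose successively [f k] of least degree outside
    the ideal of its predecessors. For some [N] the leading coefficient of [f N] is a combination of
    earlier ones, so subtracting a combination of predecessors lowers its degree: a
    contradiction. *)
Lemma hilbert_basis (A : comNzRingType) : noetherian A -> noetherian {poly A}.
Proof.
move=> nA; apply: noetherian_ideal_gen => I idI; apply: contrapT => no.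
have /choice[next nextP] : forall s : seq {poly A}, exists g, (forall x, x \in s -> I x) ->
    [/\ I g, ~ combination s g & forall g', I g' -> ~ combination s g' -> (size g <= size g')%N].
  move=> s; have [sI|nsI] := pselect (forall x, x \in s -> I x); last by exists 0.
  have exg : exists d, asbool (exists g, [/\ I g, ~ combination s g & size g = d]).
    apply: contrapT => no2; apply: no; exists s; split=> // x Ix; apply: contrapT => nx.
    by apply: no2; exists (size x); apply/asboolP; exists x.
  case: (ex_minnP exg) => d /asboolP[g [Ig ng sg]] dmin; exists g => _; split=> // g' Ig' ng'.
  by rewrite sg; apply: dmin; apply/asboolP; exists g'.
pose fix L k := if k is k'.+1 then rcons (L k') (next (L k')) else [::].
pose f k := next (L k).
have LI k : forall x, x \in L k -> I x.
  elim: k => [//|k IH] x /=; rewrite mem_rcons inE => /orP[/eqP ->|/IH//].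
  by have [] := nextP _ IH.
have sL k : size (L k) = k by elim: k => //= k IH; rewrite size_rcons IH.
have nL k i : (i < k)%N -> (L k)`_i = f i.
  elim: k => // k IH; rewrite ltnS leq_eqVlt => /orP[/eqP ->|ik] /=.
    by rewrite nth_rcons sL ltnn eqxx.
  by rewrite nth_rcons sL ik IH.
have mL k i : (i < k)%N -> f i \in L k.
  by move=> ik; rewrite -(nL _ _ ik) mem_nth // sL.
have subL k i : (i <= k)%N -> {subset L i <= L k}.
  move=> ik x /(nthP 0)[j]; rewrite sL => ji; rewrite nL // => <-.
  by apply: mL; apply: leq_trans ik.
have fP k := nextP _ (LI k).
have fmono i k : (i <= k)%N -> (size (f i) <= size (f k))%N.
  move=> ik; have [_ _ h] := fP i; have [Ik nk _] := fP k; apply: h => // hc; apply: nk.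
  apply: combination_min hc; first exact: combination_ideal.
  by move=> y /(subL _ _ ik); apply: combination_mem.
have [s [sS sP]] := nA (fun a => exists k, a = lead_coef (f k)).
have [N hN] : exists N, forall x, x \in s -> exists2 k, (k < N)%N & x = lead_coef (f k).
  elim: s sS {sP} => [|x s IH] sS; first by exists 0%N.
  have [|N hN] := IH; first by move=> y ys; apply: sS; rewrite inE ys orbT.
  have [|k xk] := sS x; first exact: mem_head.
  exists (maxn N k.+1) => y; rewrite inE => /orP[/eqP ->|/hN[j jN yj]].
    by exists k; rewrite // leq_max ltnSn orbT.
  by exists j; rewrite // leq_max jN.
have [IN nN minN] := fP N.
pose D := size (f N).
(* Coefficients, in the degree of [f N], of elements of the ideal of [L N] of at most that degree.
   Multiplying each earlier [f k] by a power of ['X] shows that [K] contains its leading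
   coefficient. *)
pose K (x : A) := exists u, combination (L N) u /\ (size u <= D)%N /\ u`_D.-1 = x.
have step x : combination s x -> K x.
  apply: combination_min.
    split; first by exists 0; split; [exact: ideal0 (combination_ideal _)|rewrite size_poly0 coef0].
    move=> a _ _ [u [cu [su <-]]] [v [cv [sv <-]]]; exists (a%:P * u + v); split.
      by have [_ h] := combination_ideal (L N); apply: h.
    rewrite coefD coefCM; split=> //; apply: (leq_trans (size_polyD _ _)).
    by rewrite geq_max sv andbT mul_polyC (leq_trans (size_scale_leq _ _)).
  move=> _ /hN[k kN ->]; exists ('X^(D - size (f k)) * f k); split.
    by apply: idealMl; [exact: combination_ideal|apply: combination_mem; apply: mL].
  have sk : (size (f k) <= D)%N by apply: fmono; apply: ltnW.
  have k0 : (0 < size (f k))%N.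
    rewrite size_poly_gt0; apply/eqP => fk0; have [_ nk _] := fP k; apply: nk.
    by rewrite -/(f k) fk0; apply: ideal0 (combination_ideal _).
  split; first by rewrite mulrC (leq_trans (size_polyMleq _ _)) // size_polyXn addnS /= subnKC.
  rewrite coefXnM lead_coefE.
  have -> : (D.-1 < D - size (f k))%N = false.
    by apply/negbTE; rewrite -leqNgt -subn1 leq_sub2l.
  by congr (_ `_ _); rewrite -!subn1 subnAC subKn.
have [u [cu [su eu]]] := step _ (sP _ (ex_intro _ N erefl)).
have cN : ~ combination (L N) (f N - u).
  move=> h; apply: nN; rewrite -/(f N) -[f N](subrK u).
  exact: (idealD (combination_ideal (L N)) h cu).
have Iu : I (f N - u) by apply: idealB => //; apply: combination_min cu => //; apply: LI.
have := minN _ Iu cN; rewrite -/(f N) -/D leqNgt => /negP; apply.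
have D0 : (0 < D)%N.
  rewrite size_poly_gt0; apply/eqP => fk0; apply: nN.
  by rewrite -/(f N) fk0; apply: ideal0 (combination_ideal _).
rewrite -(prednK D0) ltnS; apply/leq_sizeP => j; rewrite leq_eqVlt => /orP[/eqP <-|Dj].
  by rewrite coefB eu lead_coefE subrr.
have Dj' : (D <= j)%N by rewrite -(prednK D0).
by rewrite coefB !nth_default ?subrr // (leq_trans su).
Qed.

End Ideals.

Module AffineGeometry.
Import mpoly Ideals.
Import Order.TTheory GRing.Theory Num.Theory.
Local Open Scope ring_scope.

(** * Noether normalization *)

Lemma mpoly_rmorph_ext n (R S : comNzRingType) (f g : {rmorphism {mpoly R[n]} -> S}) :
  (forall c, f c%:MP = g c%:MP) -> (forall i, f 'X_i = g 'X_i) -> f =1 g.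
Proof.
move=> hC hX p; rewrite (mpolyE p) !rmorph_sum; apply: eq_bigr => m _.
rewrite -mul_mpolyC !rmorphM hC; congr (_ * _).
by rewrite mpolyXE_id !rmorph_prod; apply: eq_bigr => i _; rewrite !rmorphXn hX.
Qed.

Section Shear.
Variables (n : nat) (F : fieldType) (w : 'I_n -> nat).

(** Nagata's change of variables: the first variable becomes the main one ['X], and ['X^(w j)] is
    added to each other variable. *)
Definition shear : {mpoly F[n.+1]} -> {poly {mpoly F[n]}} :=
  mmap (polyC \o mpolyC n (R := F))
       (fun i => if unlift ord0 i is Some j then ('X_j)%:P + 'X^(w j) else 'X).

HB.instance Definition _ := GRing.RMorphism.on shear.

Definition unshear_var (S : comNzRingType) (p : {mpoly F[n.+1]} -> S) (j : 'I_n) : S :=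
  p 'X_(lift ord0 j) - p 'X_ord0 ^+ w j.

(** The shear is undone by substituting [unshear_var]: both sides are ring morphisms in [G] that
    agree on constants and variables. *)
Lemma shear_eval (S : comNzRingType) (p : {rmorphism {mpoly F[n.+1]} -> S}) G :
  (map_poly (mmap (p \o mpolyC n.+1 (R := F)) (unshear_var p)) (shear G)).[p 'X_ord0] = p G.
Proof.
set f := mmap _ _.
suff: (horner_eval (p 'X_ord0) \o map_poly f \o shear) =1 p by move/(_ G).
apply: mpoly_rmorph_ext => [c|i] /=.
  by rewrite /shear mmapC /= map_polyC /= /horner_eval hornerC /f mmapC.
rewrite /shear mmapX mmap1U /horner_eval; case: unliftP => [j|] ->.
  by rewrite rmorphD /= map_polyC map_polyXn /= hornerD hornerC hornerXn /f mmapX mmap1U subrK.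
by rewrite map_polyX hornerX.
Qed.

End Shear.

Lemma digits_inj N n (a b : 'I_n -> nat) :
  (forall i, a i < N)%N -> (forall i, b i < N)%N ->
  (\sum_i a i * N ^ i = \sum_i b i * N ^ i)%N -> a =1 b.
Proof.
elim: n a b => [|n IH] a b ha hb; first by move=> _ [].
have N_gt0 : (0 < N)%N by apply: leq_ltn_trans (ha ord0).
have step (c : 'I_n.+1 -> nat) :
    (\sum_i c i * N ^ i = (\sum_(i < n) c (lift ord0 i) * N ^ i) * N + c ord0)%N.
  rewrite big_ord_recl expn0 muln1 addnC big_distrl /=; congr addn.
  by apply: eq_bigr => i _; rewrite /bump /= add1n expnSr mulnA.
rewrite !step => e; have e0 : a ord0 = b ord0.
  by have /(congr1 (modn^~ N)) := e; rewrite !modnMDl !modn_small.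
move: e; rewrite e0 => /addIn/eqP; rewrite eqn_pmul2r // => /eqP /IH h i.
by case: (unliftP ord0 i) => [j ->|->] //; apply: (h (fun _ => ha _) (fun _ => hb _) j).
Qed.

Section ShearMonomial.
Variables (n : nat) (F : fieldType) (w : 'I_n -> nat).
Hypothesis w_gt0 : forall j, (0 < w j)%N.
Local Notation wt m := (m ord0 + \sum_j m (lift ord0 j) * w j)%N.

(** Since [w j] is positive, each variable becomes a monic polynomial in ['X], and degrees of monic
    factors add up. *)
Lemma shear_mono (m : 'X_{1..n.+1}) :
  shear w 'X_[F, m] \is monic /\ size (shear w 'X_[F, m]) = (wt m).+1.
Proof.
have hM (I : finType) (p : I -> {poly {mpoly F[n]}}) (k : I -> nat) :
    (forall i, p i \is monic /\ size (p i) = (k i).+1) ->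
    \prod_i p i \is monic /\ size (\prod_i p i) = (\sum_i k i).+1.
  move=> h; split; first by apply: monic_prod => i _; case: (h i).
  rewrite size_prod => [|i _]; last by rewrite monic_neq0 //; case: (h i).
  rewrite (eq_bigr (fun i => k i + 1)%N) => [|i _]; last by case: (h i) => _ ->; rewrite addn1.
  by rewrite big_split /= sum1_card subSn ?leq_addl // addnK.
have hX (p : {poly {mpoly F[n]}}) a k : p \is monic -> size p = a.+1 ->
    p ^+ k \is monic /\ size (p ^+ k) = (k * a).+1.
  move=> mp sp; split; first exact: monic_exp.
  have := size_exp p k; rewrite sp /= mulnC => <-.
  by rewrite prednK // size_poly_gt0 monic_neq0 // monic_exp.
pose h (i : 'I_n.+1) : {poly {mpoly F[n]}} :=
  if unlift ord0 i is Some j then ('X_j)%:P + 'X^(w j) else 'X.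
pose k (i : 'I_n.+1) := (m i * if unlift ord0 i is Some j then w j else 1)%N.
have -> : wt m = (\sum_i k i)%N.
  rewrite big_ord_recl /k unlift_none muln1; congr addn.
  by apply: eq_bigr => i _; rewrite liftK.
rewrite /shear mmapX /mmap1; apply: (hM _ (fun i => h i ^+ m i) k) => i.
apply: hX; rewrite /h; case: unliftP => [j|] _; rewrite ?monicX ?size_polyX //.
  rewrite monicE addrC lead_coefDl ?lead_coefXn // size_polyXn ltnS.
  by rewrite (leq_trans (size_polyC_leq1 _)).
by rewrite addrC size_polyDl size_polyXn // ltnS (leq_trans (size_polyC_leq1 _)).
Qed.
End ShearMonomial.

(** With weights the powers of an [N] above all exponents, the weight of a monomial has its
    exponents as base [N] digits. Distinct monomials thus get distinct degrees, and the one of top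
    degree alone gives the leading coefficient, a constant. *)
Lemma shear_quasi_monic n (F : fieldType) (G : {mpoly F[n.+1]}) : G != 0 ->
  exists (w : 'I_n -> nat) (c : F), c != 0 /\ lead_coef (shear w G) = c%:MP.
Proof.
move=> G0; pose N := (msize G).+1.
pose w (j : 'I_n) := (N ^ j.+1)%N.
have w_gt0 j : (0 < w j)%N by rewrite expn_gt0.
pose wt (m : 'X_{1..n.+1}) := (m ord0 + \sum_j m (lift ord0 j) * w j)%N.
have wtE m : wt m = (\sum_i m i * N ^ i)%N by rewrite big_ord_recl expn0 muln1.
have lt_N m i : m \in msupp G -> (m i < N)%N.
  move/msize_mdeg_lt => h; rewrite ltnS (leq_trans _ (ltnW h)) //.
  by rewrite mdegE (bigD1 i) //= leq_addr.
have wt_inj : {in msupp G &, injective wt}.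
  move=> m1 m2 h1 h2; rewrite !wtE => /digits_inj h.
  by apply/mnmP => i; apply: h => j; apply: lt_N.
have [m0 hm0] : exists m, m \in msupp G.
  by exists (mlead G); apply: mlead_supp.
have [m hm maxm] : exists2 m, m \in msupp G & {in msupp G, forall m', (wt m' <= wt m)%N}.
  have: exists k, has (fun m => wt m == k) (msupp G).
    by exists (wt m0); apply/hasP; exists m0.
  have hb k : has (fun m => wt m == k) (msupp G) -> (k <= \max_(m <- msupp G) wt m)%N.
    by case/hasP => m hm /eqP <-; apply: (leq_bigmax_seq _ hm).
  move=> ex; case: (ex_maxnP ex hb) => k /hasP [m hm /eqP <-] mx.
  by exists m => // m' hm'; apply: mx; apply/hasP; exists m'.
exists w, G@_m; rewrite -mcoeff_msupp; split=> //.
have sG (m' : 'X_{1..n.+1}) : shear w (G@_m' *: 'X_[m']) = (G@_m')%:MP *: shear w 'X_[m'].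
  by rewrite -mul_mpolyC rmorphM /= {1}/shear mmapC /= mul_polyC.
have mcn0 m' : m' \in msupp G -> (G@_m')%:MP_[n] != 0.
  by rewrite mcoeff_msupp mpolyC_eq0.
rewrite [in LHS](mpolyE G) rmorph_sum /= (bigD1_seq m) ?msupp_uniq //= sG.
have [mon sz] := shear_mono F w_gt0 m.
rewrite lead_coefDl; first by rewrite lead_coefZ (monicP mon) mulr1.
rewrite size_scale ?mcn0 // sz ltnS big_seq_cond.
apply: (leq_trans (size_sum _ _ _)); apply/bigmax_leqP_seq => m' hm' /andP[_ ne].
rewrite sG size_scale ?mcn0 // (shear_mono F w_gt0 m').2 -/(wt m) -/(wt m').
rewrite ltn_neqAle maxm // andbT; apply: contra ne => /eqP /wt_inj-> //.
Qed.

Definition subst m n (F : fieldType) (Y : 'I_m -> {mpoly F[n]}) : {mpoly F[m]} -> {mpoly F[n]} :=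
  mmap (mpolyC n (R := F)) Y.
HB.instance Definition _ m n F Y := GRing.RMorphism.on (@subst m n F Y).

Lemma substC m n (F : fieldType) (Y : 'I_m -> {mpoly F[n]}) c : subst Y c%:MP = c%:MP.
Proof. by rewrite /subst mmapC. Qed.

Lemma substX m n (F : fieldType) (Y : 'I_m -> {mpoly F[n]}) i : subst Y 'X_i = Y i.
Proof. by rewrite /subst mmapX mmap1U. Qed.

Lemma meval_subst m n (F : fieldType) (Y : 'I_m -> {mpoly F[n]}) v G :
  meval v (subst Y G) = meval (fun i => meval v (Y i)) G.
Proof.
pose f : {rmorphism {mpoly F[m]} -> F} := meval v \o subst Y.
apply: (@mpoly_rmorph_ext _ _ _ f) => [c|i] /=.
  by rewrite substC !mevalC.
by rewrite substX mevalXU.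
Qed.

Lemma integral_mpoly n (F : fieldType) (A B : comNzRingType) (f : {rmorphism A -> B})
    (g : {rmorphism {mpoly F[n]} -> B}) :
  (forall c, integralOver f (g c%:MP)) -> (forall i, integralOver f (g 'X_i)) ->
  forall G, integralOver f (g G).
Proof.
move=> hC hX G; rewrite (mpolyE G) rmorph_sum.
elim/big_ind: _ => [|x y|m _]; [exact: integral0|exact: integral_add|].
rewrite -mul_mpolyC rmorphM; apply: integral_mul => //.
rewrite mpolyXE_id rmorph_prod; elim/big_ind: _ => [|x y|i _]; [exact: integral1|exact: integral_mul|].
rewrite rmorphXn; elim: (m i) => [|k IH]; first exact: integral1.
by rewrite exprS; apply: integral_mul.
Qed.

(** Induction on [n]. If [f] is injective the variables serve as [Y]; otherwise a shear of a nonzero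
    element of the kernel makes the first variable integral over the [n] sheared ones. *)
Lemma noether_normalization n (F : fieldType) (B : comNzRingType)
    (f : {rmorphism {mpoly F[n]} -> B}) :
  exists r (Y : 'I_r -> {mpoly F[n]}),
    (forall G, f (subst Y G) = 0 -> G = 0) /\
    forall i, integralOver (f \o subst Y) (f 'X_i).
Proof.
have noker m (g : {rmorphism {mpoly F[m]} -> B}) :
    ~ (exists G, g G = 0 /\ G <> 0) ->
    exists r (Y : 'I_r -> {mpoly F[m]}), (forall G, g (subst Y G) = 0 -> G = 0) /\
      forall i, integralOver (g \o subst Y) (g 'X_i).
  move=> inj; exists m, (fun i => 'X_i).
  have e (G : {mpoly F[m]}) : subst (fun i => 'X_i) G = G.
    pose h : {rmorphism _ -> _} := subst (fun i : 'I_m => 'X_i : {mpoly F[m]}).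
    suff hid : h =1 idfun by exact: (hid G).
    by apply: mpoly_rmorph_ext => [c|i] /=; rewrite ?substC ?substX.
  split=> [G|i]; first by rewrite e => hG; apply: boolp.contrapT => G0; apply: inj; exists G.
  by have := integral_id (g \o subst (fun i => 'X_i : {mpoly F[m]})) 'X_i; rewrite /= e.
elim: n f => [|n IH] f.
  apply: noker => -[G [fG G0]]; pose c := G@_0%MM.
  have eG : G = c%:MP by apply: nvar0_mpolyC.
  have c0 : c != 0 by apply/eqP => c0; apply: G0; rewrite eG c0.
  suff: 1 = 0 :> B by move/eqP; rewrite oner_eq0.
  by rewrite -(rmorph1 f) -[RHS](mulr0 (f (c^-1)%:MP)) -fG eG -rmorphM -mpolyCM mulVf.
have [[G [fG G0]]|] := boolp.pselect (exists G, f G = 0 /\ G <> 0); last exact: noker.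
move/eqP: G0 => /shear_quasi_monic[w [c [c0 lc]]].
(* [g] is [f] on the subring of the sheared variables, and [t] is the inclusion of that subring. *)
pose g : {rmorphism {mpoly F[n]} -> B} := mmap (f \o mpolyC n.+1 (R := F)) (unshear_var w f).
pose t : {rmorphism {mpoly F[n]} -> {mpoly F[n.+1]}} := subst (unshear_var w idfun).
have gE : f \o t =1 g.
  apply: mpoly_rmorph_ext => [d|i] /=; first by rewrite substC /g /= mmapC.
  by rewrite substX /g /= mmapX mmap1U /unshear_var rmorphB rmorphXn.
have [r [Y [injY intY]]] := IH g.
exists r, (fun i => t (Y i)).
have fY : f \o subst (fun i => t (Y i)) =1 g \o subst Y.
  apply: mpoly_rmorph_ext => [d|i] /=; first by rewrite !substC -gE /= substC.
  by rewrite !substX -gE.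
have fYE : f \o subst (fun i => t (Y i)) = g \o subst Y by apply: boolp.funext.
split=> [H|i]; first by have := fY H => /= ->; apply: injY.
rewrite fYE.
have intg H : integralOver (g \o subst Y) (g H).
  apply: integral_mpoly => // d.
  by have := integral_id (g \o subst Y) d%:MP; rewrite /= substC.
have int0 : integralOver (g \o subst Y) (f 'X_ord0).
  have := shear_eval w f G; rewrite fG -/g => e.
  apply: (@integral_root_monic _ _ _ _ (map_poly g ((c^-1)%:MP *: shear w G))).
  - by apply: monic_map; rewrite monicE lead_coefZ lc -mpolyCM mulVf.
  - by rewrite map_polyZ rootE hornerZ e mulr0.
  - by apply/integral_poly => j; rewrite coef_map; apply: intg.
case: (unliftP ord0 i) => [j|] -> //.
have -> : f 'X_(lift ord0 j) = g 'X_j + f 'X_ord0 ^+ w j.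
  by rewrite /g /= mmapX mmap1U /unshear_var subrK.
apply: integral_add => //; elim: (w j) => [|k IHk]; first exact: integral1.
by rewrite exprS; apply: integral_mul.
Qed.

(** * Extension of specializations *)

(* F may drop in degree when specialized, so the resultant is taken with the
   monic polynomial F + p X^N. *)
Lemma specialized_unit_ideal (C : fieldType) (R B : comNzRingType) (e : {rmorphism R -> C})
    (f : {rmorphism R -> B}) (b : B) (p F : {poly R}) (c : C) :
  (forall a, f a = 0 -> e a = 0) ->
  p \is monic -> root (map_poly f p) b -> (map_poly f F).[b] = 0 ->
  map_poly e F = c%:P -> c = 0.
Proof.
move=> ker mp rp rF eF; apply/eqP/negPn/negP => c0.
have sp : (1 < size p)%N.
  rewrite ltnNge; apply/negP => sp.
  have p1 : p = 1.
    move: mp; rewrite (size1_polyC sp) monicE lead_coefC => /eqP ->; exact: polyC1.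
  by move: rp; rewrite p1 rmorph1 rootC oner_eq0.
pose N := size F; pose G := F + p * 'X^N.
have sG : (size F < size (p * 'X^N)%R)%N.
  by rewrite size_Mmonic ?monicXn ?monic_neq0 // size_polyXn addnS /= /N -{1}[size F]add0n ltn_add2r (ltnW sp).
have mG : G \is monic by rewrite monicE lead_coefDr // (monicP _) // monicMr ?monicXn.
have szG : (1 < size G)%N.
  rewrite /G addrC size_polyDl // size_Mmonic ?monicXn ?monic_neq0 // size_polyXn addnS /=.
  by rewrite (leq_trans sp) // leq_addr.
(* The resultant is formed over [{poly R}]; [e0] and [f0] set the additional variable to 0. *)
pose e0 : {rmorphism {poly R} -> C} := e \o horner_eval 0.
pose f0 : {rmorphism {poly R} -> B} := f \o horner_eval 0.
have e0P (q : {poly R}) : map_poly e0 (map_poly polyC q) = map_poly e q.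
  by rewrite -map_poly_comp; apply: eq_map_poly => x; rewrite /e0 /= /horner_eval hornerC.
have f0P (q : {poly R}) : map_poly f0 (map_poly polyC q) = map_poly f q.
  by rewrite -map_poly_comp; apply: eq_map_poly => x; rewrite /f0 /= /horner_eval hornerC.
pose r := resultant (map_poly polyC p) (map_poly polyC G).
have szP (q : {poly R}) : size (map_poly polyC q) = size q by rewrite size_map_polyC.
(* Specialized, [G] is a nonzero constant plus a multiple of [p], hence coprime to [p]. *)
have e_r : e0 r != 0.
  have lcP (q : {poly R}) : q \is monic -> e0 (lead_coef (map_poly polyC q)) != 0.
    move=> mq; rewrite lead_coef_map_inj //; last exact: polyC_inj.
    by rewrite (monicP mq) /e0 /= /horner_eval hornerC rmorph1 oner_neq0.
  rewrite map_resultant ?lcP // !e0P resultant_eq0 rmorphD rmorphM /= map_polyXn eF.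
  have /eqP -> // : coprimep (map_poly e p) (c%:P + map_poly e p * 'X^N).
  by rewrite addrC mulrC coprimep_addl_mul -alg_polyC coprimepZr // coprimep1.
(* The resultant is a combination of [p] and [G], both of which vanish at [b]. *)
have f_r : f0 r = 0.
  have [|| [u v] _ /(congr1 (fun q => (map_poly f0 q).[b]))] := @resultant_in_ideal _ (map_poly polyC p) (map_poly polyC G).
  - by rewrite szP.
  - by rewrite szP.
  rewrite map_polyC hornerC => ->.
  rewrite rmorphD !rmorphM /= hornerD !hornerM !f0P (rootP rp) /G rmorphD rmorphM /= hornerD hornerM rF (rootP rp).
  by rewrite mul0r !mulr0 add0r addr0 mulr0.
by move/eqP: e_r; apply; apply: ker.
Qed.

(** Among the relations of [b] with nonzero specialization take one, [F], of least specialized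
    degree. It does not specialize to a constant, so it has a root [s]; division shows that every
    other relation specializes to a multiple of it. *)
Lemma extend_specialization (C : closedFieldType) (R B : comNzRingType) (k : {rmorphism C -> R})
    (e : {rmorphism R -> C}) (f : {rmorphism R -> B}) (b : B) :
  cancel k e -> (forall a, f a = 0 -> e a = 0) -> integralOver f b ->
  exists s, forall F : {poly R}, (map_poly f F).[b] = 0 -> (map_poly e F).[s] = 0.
Proof.
move=> kK ker [p mp rp].
pose P d := boolp.asbool (exists F : {poly R},
  [/\ (map_poly f F).[b] = 0, map_poly e F != 0 & size (map_poly e F) = d]).
have exP : exists d, P d.
  exists (size (map_poly e p)); apply/boolp.asboolP; exists p; split=> //; first exact/rootP.
  by rewrite monic_neq0 // monic_map.
case: (ex_minnP exP) => d /boolp.asboolP [F [fF eF0 sF]] dmin.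
have : size (map_poly e F) != 1.
  apply/negP => /size_poly1P[c c0 eF]; move/eqP: c0; apply.
  exact: (specialized_unit_ideal ker mp rp fF eF).
case/closed_rootP => s /rootP rs; exists s => G fG.
set g := map_poly e F in eF0 sF rs.
have kkP (q : {poly C}) : map_poly e (map_poly k q) = q.
  by rewrite -map_poly_comp; apply: map_poly_id => x _; apply: kK.
(* The quotient is computed over [C] and lifted by [k], so that [H] is again a relation of [b]. *)
pose q := map_poly e G %/ g; pose H := G - map_poly k q * F.
have eH : map_poly e H = map_poly e G %% g.
  rewrite /H rmorphB rmorphM /= kkP -/g.
  by rewrite {1}(divp_eq (map_poly e G) g) -/q addrC addKr.
rewrite (divp_eq (map_poly e G) g) -eH hornerD hornerM rs mulr0 add0r.
suff -> : map_poly e H = 0 by rewrite horner0.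
apply/eqP/negPn/negP => H0.
have : P (size (map_poly e H)).
  apply/boolp.asboolP; exists H; split=> //.
  by rewrite /H rmorphB rmorphM /= hornerD hornerN hornerM fF fG mulr0 subr0.
by move/dmin; rewrite leqNgt eH -sF ltn_modp eF0.
Qed.

(** Adjoins the elements one by one: [R] becomes [{poly R}], whose variable goes to [b] in [B] and
    to [t] in [C]. The choice of [t] preserves the condition on kernels. *)
Lemma extend_specialization_seq (C : closedFieldType) (B : comNzRingType) (s : seq B) :
  forall (R : comNzRingType) (k : {rmorphism C -> R})
    (e : {rmorphism R -> C}) (f : {rmorphism R -> B}),
  cancel k e -> (forall a, f a = 0 -> e a = 0) -> {in s, forall b, integralOver f b} ->
  exists (R' : comNzRingType) (i : {rmorphism R -> R'}) (e' : {rmorphism R' -> C})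
    (f' : {rmorphism R' -> B}),
    [/\ e' \o i =1 e, f' \o i =1 f, forall a, f' a = 0 -> e' a = 0
      & {in s, forall b, exists a, f' a = b}].
Proof.
elim: s => [|b s IH] R k e f kK ker int.
  by exists R, idfun, e, f; split.
have [|t ht] := extend_specialization kK ker (b := b); first by apply: int; rewrite mem_head.
pose k1 : {rmorphism C -> {poly R}} := polyC \o k.
pose e1 : {rmorphism {poly R} -> C} := horner_eval t \o map_poly e.
pose f1 : {rmorphism {poly R} -> B} := horner_eval b \o map_poly f.
have e1C a : e1 a%:P = e a by rewrite /e1 /= map_polyC /horner_eval hornerC.
have f1C a : f1 a%:P = f a by rewrite /f1 /= map_polyC /horner_eval hornerC.
have [||c hc|R' [i [e' [f' [e'E f'E ker' sur]]]]] := IH _ k1 e1 f1.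
- by move=> c; apply: etrans (e1C _) (kK c).
- by move=> F; apply: ht.
- have [|p mp rp] := int c; first by rewrite inE hc orbT.
  exists (map_poly polyC p); first exact: monic_map.
  rewrite -map_poly_comp; suff -> : map_poly (f1 \o polyC) p = map_poly f p by [].
  by apply: eq_map_poly => x; apply: f1C.
exists R', (i \o polyC), e', f'; split=> // [a|a|c].
- exact: etrans (e'E _) (e1C _).
- exact: etrans (f'E _) (f1C _).
rewrite inE => /orP[/eqP -> |]; last exact: sur.
exists (i 'X); apply: etrans (f'E _) _.
by rewrite /f1 /= map_polyX /horner_eval hornerX.
Qed.

(** Going up for points: the specialization [e] of the image of [f] extends to the images of the
    variables, and [z] collects their values. *)
Lemma specialize_integral (C : closedFieldType) n (B R : comNzRingType)
    (p : {rmorphism {mpoly C[n]} -> B}) (k : {rmorphism C -> R})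
    (e : {rmorphism R -> C}) (f : {rmorphism R -> B}) :
  cancel k e -> (forall a, f a = 0 -> e a = 0) -> (forall c, f (k c) = p c%:MP) ->
  (forall i, integralOver f (p 'X_i)) ->
  exists z : 'I_n -> C, forall a F, f a = p F -> e a = F.@[z].
Proof.
move=> kK ker kE int.
have [|R' [i [e' [f' [e'E f'E ker' sur]]]]] :=
  extend_specialization_seq (s := [seq p 'X_i | i <- enum 'I_n]) kK ker.
  by move=> _ /mapP[i _ ->].
have /boolp.choice[a aE] : forall j : 'I_n, exists a, f' a = p 'X_j.
  by move=> j; apply: sur; apply: map_f; rewrite mem_enum.
pose h : {rmorphism {mpoly C[n]} -> R'} := mmap (i \o k) a.
have hX j : h 'X_j = a j by rewrite /h /= mmapX mmap1U.
have hC c : h c%:MP = i (k c) by rewrite /h /= mmapC.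
exists (e' \o a) => x F xF.
have <- : e' (h F) = F.@[e' \o a].
  pose g : {rmorphism _ -> _} := e' \o h.
  apply: (@mpoly_rmorph_ext _ _ _ g) => [c|j]; rewrite /g /=.
    by rewrite hC mevalC; have /= -> := e'E (k c).
  by rewrite hX mevalXU.
have hF : f' (h F) = p F.
  pose g : {rmorphism _ -> _} := f' \o h.
  apply: (@mpoly_rmorph_ext _ _ _ g) => [c|j]; rewrite /g /=.
    by rewrite hC; have /= -> := f'E (k c).
  by rewrite hX aE.
have /= <- := e'E x.
apply/eqP; rewrite -subr_eq0 -rmorphB; apply/eqP/ker'.
by rewrite rmorphB hF -xF; have /= -> := f'E x; rewrite subrr.
Qed.

(** * Monic minimal polynomials over polynomial rings *)

(** The points [d / k.+1%:R] for [k < size p] outnumber the roots of [p]. *)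
Lemma poly_nonroot_near0 (C : numFieldType) (p : {poly C}) (d : C) : p != 0 -> 0 < d ->
  exists t, [/\ 0 < t, t <= d & p.[t] != 0].
Proof.
move=> p0 d0; pose s := [seq d / k.+1%:R | k <- iota 0 (size p)].
have [all_s|] := boolP (all (root p) s).
  have us : uniq s.
    rewrite map_inj_uniq ?iota_uniq // => i j /(mulfI (lt0r_neq0 d0))/invr_inj/eqP.
    by rewrite eqr_nat => /eqP[].
  by have := max_poly_roots p0 all_s us; rewrite size_map size_iota ltnn.
case/allPn => t /mapP[k _ ->] r; exists (d / k.+1%:R); split=> //.
  by rewrite divr_gt0 // ltr0n.
by rewrite ler_pdivrMr ?ltr0n // ler_peMr ?ler1n // ltW.
Qed.

(** After a shear the leading coefficient is a constant, so it survives setting the other variables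
    to 0; a nonroot of the resulting polynomial is then sheared back. *)
Lemma mpoly_nonzero_point n (C : numFieldType) (G : {mpoly C[n]}) : G != 0 ->
  exists x, G.@[x] != 0.
Proof.
case: n G => [|n] G G0.
  by exists (fun=> 0); move: G0; rewrite {1 2}(nvar0_mpolyC G) mpolyC_eq0 mevalC.
have [w [c [c0 lc]]] := shear_quasi_monic G0.
pose g0 := map_poly (meval (fun _ : 'I_n => 0 : C)) (shear w G).
have g0_neq0 : g0 != 0.
  by rewrite -lead_coef_eq0 lead_coef_map_eq lc /= mevalC.
have [t [_ _ rt]] := poly_nonroot_near0 g0_neq0 (@ltr01 C).
pose x (i : 'I_n.+1) := if unlift ord0 i is Some j then t ^+ w j else t.
exists x; pose h : {rmorphism {mpoly C[n.+1]} -> C} := meval x.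
have h0 : h 'X_ord0 = t by rewrite /h /= mevalXU /x unlift_none.
have := shear_eval w h G; rewrite h0.
suff /eq_map_poly -> : mmap (h \o mpolyC n.+1 (R := C)) (unshear_var w h) =1 meval (fun=> 0).
  by rewrite -/g0 /= => <-.
apply: mpoly_rmorph_ext => [d|i] /=; first by rewrite mmapC mevalC /= mevalC.
rewrite mmapX mmap1U mevalXU /unshear_var h0 /h /= mevalXU /x liftK; exact: subrr.
Qed.

(** Gauss's lemma, by removing the linear factors of [a] one at a time: each of them divides [q] or
    [q2], since evaluation at its root lands in a domain. Once [a] is a unit, so is
    [lead_coef q]. *)
Lemma gauss_lead_dvd (C : closedFieldType) (q q2 p : {poly {poly C}}) (a : {poly C}) :
  p \is monic -> a != 0 -> q * q2 = a *: p -> forall j, lead_coef q %| q`_j.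
Proof.
move=> mp; move: {2}(size a) (leqnn (size a)) => n.
elim: n a q q2 => [|n IH] a q q2; first by rewrite leqn0 size_poly_eq0 => ->.
move=> sa a0 e j.
have le : lead_coef q * lead_coef q2 = a by rewrite -lead_coefM e lead_coefZ (monicP mp) mulr1.
have [s1|s1] := eqVneq (size a) 1%N.
  suff : lead_coef q %| 1 by move/dvdp_trans; apply; apply: dvd1p.
  have -> : (lead_coef q %| 1) = (lead_coef q %| a).
    by apply: eqp_dvdr; rewrite eqp_sym -size_poly_eq1 s1.
  by rewrite -le dvdp_mulr.
have /closed_rootP[x rx] := s1.
have dX : 'X - x%:P != 0 :> {poly C} by rewrite polyXsubC_eq0.
have [a' ea] := factor_theorem _ _ rx.
have a'0 : a' != 0 by apply: contraNneq a0 => a'0; rewrite ea a'0 mul0r.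
have sa' : (size a' <= n)%N.
  by move: sa; rewrite ea size_Mmonic ?monicXsubC // size_XsubC addn2.
have red (u : {poly {poly C}}) : map_poly (horner_eval x) u = 0 ->
    exists u', u = ('X - x%:P) *: u'.
  move=> hu; exists (\poly_(i < size u) (u`_i %/ ('X - x%:P))).
  apply/polyP => i; rewrite coefZ coef_poly; case: ltnP => hi; last by rewrite mulr0 nth_default.
  rewrite mulrC divpK // dvdp_XsubCl rootE.
  by have /polyP/(_ i) := hu; rewrite coef_map coef0 /= => h; apply/eqP.
have sI (u v : {poly {poly C}}) : ('X - x%:P) *: u = ('X - x%:P) *: v -> u = v.
  by rewrite -!mul_polyC; apply: mulfI; rewrite polyC_eq0.
have : map_poly (horner_eval x) q * map_poly (horner_eval x) q2 = 0.
  by rewrite -rmorphM e /= map_polyZ /= /horner_eval (rootP rx) scale0r.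
move/eqP; rewrite mulf_eq0 => /orP[] /eqP /red[u eu].
  have e' : u * q2 = a' *: p.
    apply: sI; rewrite scalerAl -eu e ea scalerA; congr (_ *: _); exact: mulrC.
  by rewrite eu lead_coefZ coefZ dvdp_mul2l // (IH a' u q2).
apply: (IH a' q u) => //.
apply: sI; rewrite scalerAr -eu e ea scalerA; congr (_ *: _); exact: mulrC.
Qed.

(* A shear makes the leading coefficient of q have a unit leading coefficient in
   X_0; the remainder of a division by it then vanishes as soon as it does after
   evaluating the other variables, which reduces the claim to C[X_0]. *)
Lemma mpoly_gauss_lead_dvd (C : numClosedFieldType) r (q q2 p : {poly {mpoly C[r]}}) a :
  p \is monic -> a != 0 -> q * q2 = a *: p -> exists q', q = lead_coef q *: q'.
Proof.
move=> mp a0 e; set c := lead_coef q.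
have c0 : c != 0.
  rewrite lead_coef_eq0; apply/eqP => q0; move: e; rewrite q0 mul0r => /esym/eqP.
  by rewrite -mul_polyC mulf_eq0 polyC_eq0 (negPf a0) (negPf (monic_neq0 mp)).
suff /boolp.choice[u uE] : forall j, exists u, q`_j = c * u.
  exists (\poly_(i < size q) u i); apply/polyP => i; rewrite coefZ coef_poly.
  by case: ltnP => hi //; rewrite mulr0 nth_default.
case: r q q2 p a mp a0 e @c c0 => [|r] q q2 p a mp a0 e c c0 j.
  exists ((c@_0%MM)^-1%:MP * q`_j); rewrite mulrA {1}(nvar0_mpolyC c) -mpolyCM mulfV ?mul1r //.
  by rewrite -(mpolyC_eq0 0%N) -nvar0_mpolyC.
(* One shear for the product [c * a], so that both factors get a unit as leading coefficient. *)
have [w [d [d0 ld]]] := shear_quasi_monic (mulf_neq0 c0 a0).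
have ud : d%:MP_[r] \is a GRing.unit.
  by apply/unitrP; exists (d^-1)%:MP; rewrite -!mpolyCM mulVf // mulfV.
move: ld; rewrite rmorphM lead_coefM => ld.
have [uc ua] : lead_coef (shear w c) \is a GRing.unit /\ lead_coef (shear w a) \is a GRing.unit.
  by apply/andP; rewrite -unitrM ld.
pose Q := shear w q`_j %/ shear w c; pose rem := shear w q`_j %% shear w c.
have divE : shear w q`_j = Q * shear w c + rem := Pdiv.IdomainUnit.divp_eq uc (shear w q`_j).
have sc0 : shear w c != 0 by rewrite -lead_coef_eq0; apply: contraTneq uc => ->; rewrite unitr0.
suff rem0 : rem = 0.
  pose h : {rmorphism {mpoly C[r.+1]} -> {mpoly C[r.+1]}} := idfun.
  pose g : {rmorphism {mpoly C[r]} -> {mpoly C[r.+1]}} :=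
    mmap (h \o mpolyC r.+1 (R := C)) (unshear_var w h).
  have ev b : b = (map_poly g (shear w b)).['X_ord0] by exact/esym/(shear_eval w h b).
  exists (map_poly g Q).['X_ord0].
  by rewrite {1}(ev q`_j) divE rem0 addr0 rmorphM hornerM mulrC -ev.
apply/polyP => i; rewrite coef0; apply/eqP/negPn/negP => /mpoly_nonzero_point[x].
(* Evaluation of all variables but ['X] at [x], where some coefficient of [rem] is supposed not to
   vanish. *)
pose g : {rmorphism {mpoly C[r.+1]} -> {poly C}} := map_poly (meval x) \o shear w.
have gU (b : {mpoly C[r.+1]}) : lead_coef (shear w b) \is a GRing.unit ->
    size (g b) = size (shear w b) /\ g b != 0.
  move=> ub; have ne : meval x (lead_coef (shear w b)) != 0.
    by rewrite -unitfE rmorph_unit.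
  have s : size (g b) = size (shear w b) by rewrite /g /= size_map_poly_id0.
  split=> //; rewrite -size_poly_eq0 s size_poly_eq0 -lead_coef_eq0.
  by apply: contraTneq ub => ->; rewrite unitr0.
have [sgc gc0] := gU _ uc; have [_ ga0] := gU _ ua.
have lg : lead_coef (map_poly g q) = g c := lead_coef_map_eq (f := g) gc0.
have gdvd : g c %| g q`_j.
  rewrite -lg -coef_map; apply: (@gauss_lead_dvd _ _ (map_poly g q2) (map_poly g p) (g a)) => //.
    by rewrite monic_map.
  by rewrite -rmorphM e /= map_polyZ.
have : g c %| map_poly (meval x) rem.
  have -> : map_poly (meval x) rem = g q`_j - map_poly (meval x) Q * g c.
    by rewrite /g /= divE rmorphD rmorphM /= addrC addKr.
  apply: dvdp_sub; first exact: gdvd.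
  exact: dvdp_mulIr.
have lt : (size (map_poly (meval x) rem) < size (g c))%N.
  by rewrite sgc (leq_ltn_trans (size_poly _ _)) // ltn_modp.
move=> dv; have [e0|ne] := eqVneq (map_poly (meval x) rem) 0.
  by have /polyP/(_ i) := e0; rewrite coef_map coef0 /= => ->; rewrite eqxx.
by have := dvdp_leq ne dv; rewrite leqNgt lt.
Qed.

(** A nonzero relation [q0] of least degree divides a constant multiple of the monic [p], by
    pseudo-division. Gauss's lemma then factors out its leading coefficient, and what remains is
    monic. *)
Lemma monic_minimal_poly (C : numClosedFieldType) r (B : comNzRingType)
    (f : {rmorphism {mpoly C[r]} -> B}) (t : B) :
  (forall x y : B, x * y = 0 -> x = 0 \/ y = 0) -> (forall a, f a = 0 -> a = 0) ->
  integralOver f t ->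
  exists q, [/\ q \is monic, root (map_poly f q) t &
    forall F, root (map_poly f F) t -> exists Q, F = Q * q].
Proof.
move=> dom inj [p mp rp].
pose P d := boolp.asbool (exists F, [/\ root (map_poly f F) t, F != 0 & size F = d]).
have exP : exists d, P d.
  by exists (size p); apply/boolp.asboolP; exists p; split=> //; apply: monic_neq0.
case: (ex_minnP exP) => d /boolp.asboolP [q0 [rq0 q00 sq0]] dmin.
have small0 F : root (map_poly f F) t -> (size F < d)%N -> F = 0.
  move=> rF; rewrite ltnNge => /negP lt; apply/eqP/negPn/negP => F0; apply: lt; apply: dmin.
  by apply/boolp.asboolP; exists F.
have e := Pdiv.Idomain.divp_eq p q0.
have m0 : p %% q0 = 0.
  apply: small0; last by rewrite -sq0 ltn_modp.
  move/(congr1 (fun u => (map_poly f u).[t])): e.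
  rewrite /= map_polyZ rmorphD rmorphM /= hornerZ hornerD hornerM (rootP rp) (rootP rq0).
  by rewrite !mulr0 add0r => e; apply/rootP.
have [q' q0E] : exists q', q0 = lead_coef q0 *: q'.
  apply: (@mpoly_gauss_lead_dvd _ _ q0 (p %/ q0) p (lead_coef q0 ^+ scalp p q0)) => //.
    by rewrite expf_neq0 // lead_coef_eq0.
  by rewrite e m0 addr0 mulrC.
have c0 : lead_coef q0 != 0 by rewrite lead_coef_eq0.
have mq : q' \is monic.
  by rewrite monicE -(inj_eq (mulfI c0)) -lead_coefZ -q0E mulr1.
have sq : size q' = d.
  by rewrite -sq0 q0E -mul_polyC size_Cmul.
have rq' : root (map_poly f q') t.
  apply/rootP; move/rootP: rq0; rewrite q0E map_polyZ hornerZ => /dom[] // /inj z.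
  by rewrite z eqxx in c0.
exists q'; split=> // F rF.
have eF := Pdiv.RingMonic.rdivp_eq mq F.
suff z : Pdiv.CommonRing.rmodp F q' = 0.
  by exists (Pdiv.CommonRing.rdivp F q'); rewrite {1}eF z addr0.
apply: small0.
  apply/rootP; move/(congr1 (fun u => (map_poly f u).[t])): eF.
  rewrite rmorphD rmorphM /= hornerD hornerM (rootP rF) (rootP rq').
  by rewrite mulr0 add0r.
by rewrite -sq Pdiv.Ring.ltn_rmodp monic_neq0.
Qed.

(** If the minimal polynomial had constant term 0, dividing it by ['X] would give a smaller
    relation. The lemma serves to keep [t] nonzero wherever this constant term is. *)
Lemma integral_nonzero_const (C : numClosedFieldType) r (B : comNzRingType)
    (f : {rmorphism {mpoly C[r]} -> B}) (t : B) :
  (forall x y : B, x * y = 0 -> x = 0 \/ y = 0) -> (forall a, f a = 0 -> a = 0) ->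
  integralOver f t -> t <> 0 ->
  exists G, root (map_poly f G) t /\ G`_0 != 0.
Proof.
move=> dom inj int t0; have [q [mq rq qmin]] := monic_minimal_poly dom inj int.
exists q; split=> //; apply/negP => q0.
have /factor_theorem[u eu] : root q 0 by rewrite rootE horner_coef0.
rewrite subr0 in eu.
have /qmin[Q eQ] : root (map_poly f u) t.
  move: rq; rewrite eu rmorphM /= map_polyX => /rootP.
  by rewrite hornerM hornerX => /dom[/rootP|].
have q_neq0 := monic_neq0 mq.
have u0 : u != 0 by apply: contraNneq q_neq0 => u0; rewrite eu u0 mul0r.
have Q0 : Q != 0 by apply: contraNneq u0 => Q0; rewrite eQ Q0 mul0r.
have : (size q <= size u)%N.
  rewrite [X in (_ <= size (polyseq X))%N]eQ size_Mmonic //.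
  by move: Q0; rewrite -size_poly_gt0; case: (size Q) => // k _; rewrite addSn leq_addl.
by rewrite [X in (size (polyseq X) <= _)%N]eu size_mulX // ltnn.
Qed.

(** * Density of generic specializations *)

Section Eventually.
Variable C : numFieldType.
(** The order is partial: [0 < t] also says that [t] is real. *)
Definition eventually0 (P : C -> Prop) := exists2 d, 0 < d & forall t, 0 < t -> t <= d -> P t.

Lemma eventually0_and P Q : eventually0 P -> eventually0 Q -> eventually0 (fun t => P t /\ Q t).
Proof.
move=> [d d0 hP] [e e0 hQ]; have de0 : 0 < d + e by rewrite addr_gt0.
(* This is below both [d] and [e], and replaces their minimum. *)
exists (d * e / (d + e)) => [|t t0 le]; first by rewrite divr_gt0 ?mulr_gt0.
split; [apply: hP | apply: hQ] => //; apply: (le_trans le); rewrite ler_pdivrMr //.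
  by rewrite ler_pM2l // lerDr ltW.
by rewrite [d * e]mulrC ler_pM2l // lerDl ltW.
Qed.

Lemma eventually0_all (I : finType) (P : I -> C -> Prop) :
  (forall i, eventually0 (P i)) -> eventually0 (fun t => forall i, P i t).
Proof.
move=> h; suff : eventually0 (fun t => forall i, i \in enum I -> P i t).
  by case=> d d0 hd; exists d => // t t0 td i; apply: hd => //; rewrite mem_enum.
elim: (enum I) => [|i s IH]; first by exists 1.
have [d d0 hd] := eventually0_and (h i) IH; exists d => // t t0 td j.
by have [hi hs] := hd t t0 td; rewrite inE => /orP[/eqP -> //|]; apply: hs.
Qed.

Lemma eventually0_linear (K e : C) : 0 <= K -> 0 < e -> eventually0 (fun t => K * t < e).
Proof.
move=> K0 e0; have d0 : 0 < K + 1 by rewrite ltr_wpDl.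
exists (e / (K + 1)) => [|t t0]; first by rewrite divr_gt0.
rewrite ler_pdivlMr // => h; apply: lt_le_trans h.
by rewrite mulrDr mulr1 mulrC ltrDl.
Qed.

Lemma eventually0_le1 : eventually0 (fun t => t <= 1).
Proof. by exists 1. Qed.

Lemma poly_norm_bound (p : {poly C}) (M : C) : 0 <= M ->
  exists2 K, 1 <= K & forall x, `|x| <= M -> `|p.[x]| <= K.
Proof.
move=> M0; exists (1 + \sum_(i < size p) `|p`_i| * M ^+ i) => [|x xM].
  by rewrite lerDl // sumr_ge0 // => i _; rewrite mulr_ge0 // exprn_ge0.
rewrite horner_coef (le_trans (ler_norm_sum _ _ _)) // ler_wpDl //.
by apply: ler_sum => i _; rewrite normrM normrX ler_wpM2l // lerXn2r ?nnegrE.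
Qed.

Lemma poly_lipschitz0 (p : {poly C}) :
  exists2 K, 0 <= K & forall x, `|x| <= 1 -> `|p.[x] - p.[0]| <= K * `|x|.
Proof.
have /factor_theorem[q e] : root (p - p.[0]%:P) 0 by rewrite rootE hornerD hornerN hornerC subrr.
have [K K1 hK] := poly_norm_bound q ler01; exists K => [|x x1]; first exact: le_trans K1.
have -> : p.[x] - p.[0] = (p - p.[0]%:P).[x] by rewrite hornerD hornerN hornerC.
by rewrite e hornerM hornerXsubC subr0 normrM ler_wpM2r // hK.
Qed.

Lemma monic_root_bound (p : {poly C}) x : p \is monic -> root p x ->
  `|x| <= 1 + \sum_(i < (size p).-1) `|p`_i|.
Proof.
move=> mp /rootP; set d := (size p).-1; set S := \sum_(i < d) _ => rx.
have S0 : 0 <= S by rewrite sumr_ge0.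
have sp : size p = d.+1 by rewrite prednK // size_poly_gt0 monic_neq0.
have [x1|x1] := real_leP (normr_real x) (@real1 C); first by rewrite ler_wpDr.
have x0 : 0 < `|x| := lt_trans ltr01 x1.
rewrite ler_wpDl // -(ler_pM2r (exprn_gt0 d x0)).
have xd : x ^+ d = - \sum_(i < d) p`_i * x ^+ i.
  apply/eqP; rewrite -addr_eq0 addrC; apply/eqP; rewrite -[RHS]rx horner_coef sp big_ord_recr /=.
  by move: mp; rewrite monicE lead_coefE -/d => /eqP ->; rewrite mul1r.
have -> : `|x| * `|x| ^+ d = `|\sum_(i < d) x * (p`_i * x ^+ i)|.
  by rewrite -mulr_sumr -(normrN (x * _)) -mulrN -xd normrM normrX.
rewrite (le_trans (ler_norm_sum _ _ _)) // mulr_suml ler_sum // => i _.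
rewrite mulrCA normrM ler_wpM2l // -exprS normrX.
by rewrite ler_eXn2l.
Qed.
End Eventually.

(** The norm of [q.[s]] is the product of the distances from [s] to the roots. *)
Lemma close_root (C : numClosedFieldType) (q : {poly C}) (s e : C) :
  q \is monic -> 0 < e -> `|q.[s]| < e ^+ (size q).-1 ->
  exists2 s1, root q s1 & `|s - s1| < e.
Proof.
move=> mq e0; have [rs qE] := closed_field_poly_normal q.
rewrite (monicP mq) scale1r in qE.
have -> : (size q).-1 = size rs by rewrite qE size_prod_XsubC.
have [[s1 [h1 h2]] _|no] := boolp.pselect (exists s1, s1 \in rs /\ `|s - s1| < e).
  by exists s1 => //; rewrite qE root_prod_XsubC.
suff -> : (`|q.[s]| < e ^+ size rs) = false by [].
apply/negbTE; rewrite -real_leNgt ?realX ?normr_real ?gtr0_real //.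
rewrite qE horner_prod normr_prod.
have {qE mq} : forall r, r \in rs -> e <= `|s - r|.
  move=> r hr; rewrite real_leNgt ?normr_real ?gtr0_real //.
  by apply/negP => h; apply: no; exists r.
elim: rs {no} => [|r rs IH] h; first by rewrite big_nil expr0.
rewrite big_cons /= exprS hornerXsubC ler_pM ?exprn_ge0 ?(ltW e0) //.
  by apply: h; rewrite mem_head.
by apply: IH => x hx; apply: h; rewrite inE hx orbT.
Qed.

Lemma root_specialization (C : numClosedFieldType) n r (B : comNzRingType)
    (p : {rmorphism {mpoly C[n]} -> B}) (Y : 'I_r -> {mpoly C[n]}) z P G :
  (forall F, p F = 0 -> F.@[z] = 0) -> root (map_poly (p \o subst Y) P) (p G) ->
  (map_poly (meval (fun i => (Y i).@[z])) P).[G.@[z]] = 0.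
Proof.
move=> sp /rootP; rewrite map_poly_comp horner_map => /sp.
rewrite -horner_map /= -map_poly_comp.
by rewrite (eq_map_poly (g := meval (fun i => (Y i).@[z]))) // => a /=; rewrite meval_subst.
Qed.

Section Line.
Variables (C : numFieldType) (r : nat) (y v : 'I_r -> C).
Definition restrict_line : {mpoly C[r]} -> {poly C} :=
  mmap polyC (fun i => (y i)%:P + (v i)%:P * 'X).
HB.instance Definition _ := GRing.RMorphism.on restrict_line.

Lemma restrict_lineE a t : (restrict_line a).[t] = a.@[fun i => y i + v i * t].
Proof.
pose g : {rmorphism _ -> _} := horner_eval t \o restrict_line.
apply: (@mpoly_rmorph_ext _ _ _ g) => [c|i]; rewrite /g /= /horner_eval.
  by rewrite /restrict_line mmapC hornerC mevalC.
by rewrite /restrict_line mmapX mmap1U mevalXU !hornerE.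
Qed.

Lemma restrict_line0 a : (restrict_line a).[0] = a.@[y].
Proof. by rewrite restrict_lineE; apply: meval_eq => i; rewrite mulr0 addr0. Qed.
End Line.

Section DenseSpecialization.
Variables (C : numClosedFieldType) (n : nat) (B : comNzRingType).
Variable p : {rmorphism {mpoly C[n]} -> B}.
Hypothesis dom : forall x y : B, x * y = 0 -> x = 0 \/ y = 0.
Variable z0 : 'I_n -> C.
Hypothesis sp0 : forall F, p F = 0 -> F.@[z0] = 0.

(** Over a point [y s] of a line through [y0], a root of the minimal polynomial of [t] close to [s0]
    extends to a point [z]. Since [t] stays away from 0 at [z], so does each [(e i).[z i]]; as [(p0
    i).[z i]] is small, [z i] is close to [z0 i]. The parameter [s] avoids the zeros of the constant
    term of [G], whence [h] does not vanish at [z]. *)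
Theorem dense_specialization h (eps : C) : p h <> 0 -> 0 < eps ->
  exists z, [/\ forall F, p F = 0 -> F.@[z] = 0, h.@[z] != 0 & forall i, `|z i - z0 i| < eps].
Proof.
move=> ph0 eps0; have [r [Y [inj int]]] := noether_normalization p.
pose f : {rmorphism {mpoly C[r]} -> B} := p \o subst Y.
have injf : forall a, f a = 0 -> a = 0 by exact: inj.
have fC c : f c%:MP = p c%:MP by rewrite /f /= substC.
have intF F : integralOver f (p F).
  by apply: integral_mpoly => // c; rewrite -fC; apply: integral_id.
have /boolp.choice[P hP] : forall i : 'I_n, exists P, P \is monic /\ root (map_poly f P) (p 'X_i).
  by move=> i; have [P ? ?] := int i; exists P.
pose y0 i := (Y i).@[z0].
pose p0 i := map_poly (meval y0) (P i).
have p0_monic i : p0 i \is monic by rewrite monic_map //; case: (hP i).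
have p0_root i : root (p0 i) (z0 i).
  have [_ /(root_specialization sp0)] := hP i.
  by rewrite mevalXU => /rootP.
have /boolp.choice[me hme] : forall i, exists me : nat * {poly C},
    ~~ root me.2 (z0 i) /\ p0 i = me.2 * ('X - (z0 i)%:P) ^+ me.1.
  move=> i; have [k [q]] := multiplicity_XsubC (p0 i) (z0 i).
  by rewrite monic_neq0 //= => nr e; exists (k, q).
pose m i := (me i).1; pose e i := (me i).2.
have er i : (e i).[z0 i] != 0 by have [] := hme i.
have p0E i : p0 i = e i * ('X - (z0 i)%:P) ^+ m i by have [] := hme i.
have m_gt0 i : (0 < m i)%N.
  rewrite lt0n; apply: contraTneq (p0_root i) => m0.
  by rewrite p0E m0 expr0 mulr1 rootE.
(* t vanishes at every point of the fibre of z0 over y0 other than z0. *)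
pose t : {mpoly C[n]} := \prod_i (map_poly (mpolyC n (R := C)) (e i)).['X_i].
have tE z : t.@[z] = \prod_i (e i).[z i].
  rewrite /t rmorph_prod; apply: eq_bigr => i _; rewrite -horner_map /= mevalXU -map_poly_comp.
  by rewrite map_poly_id // => c _ /=; rewrite mevalC.
pose s0 := t.@[z0].
have s0_neq0 : s0 != 0 by rewrite /s0 tE; apply/prodf_neq0 => i _; apply: er.
have [q [q_monic q_root q_min]] := monic_minimal_poly dom injf (intF t).
have [G [G_root G0]] := integral_nonzero_const dom injf (intF h) ph0.
have [x1 hx1] := mpoly_nonzero_point G0.
(* The line reaches [x1] at parameter 1, so the constant term of [G] does not vanish identically on
   it. *)
pose v i := x1 i - y0 i.
pose L : {rmorphism {mpoly C[r]} -> {poly C}} := restrict_line y0 v.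
pose y s i := y0 i + v i * s.
have LE a s : (L a).[s] = a.@[y s] by apply: restrict_lineE.
have L0 a : (L a).[0] = a.@[y0] by apply: restrict_line0.
have LG0 : L G`_0 != 0.
  apply: contraNneq hx1 => LG0; have := LE G`_0 1; rewrite LG0 horner0 => ->.
  by apply/eqP/meval_eq => i; rewrite /y /v mulr1 addrC subrK.
have evL (F : {poly {mpoly C[r]}}) c s :
    (map_poly L F).[c%:P].[s] = (map_poly (meval (y s)) F).[c].
  have := horner_map (horner_eval s) (map_poly L F) c%:P; rewrite /= {2 3}/horner_eval hornerC => <-.
  rewrite -map_poly_comp; congr (horner _ c); apply: eq_map_poly => a.
  by rewrite /= /horner_eval LE.
have evL0 (F : {poly {mpoly C[r]}}) c : (map_poly L F).[c%:P].[0] = (map_poly (meval y0) F).[c].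
  rewrite evL; congr (horner _ c); apply: eq_map_poly => a.
  by apply: meval_eq => i; rewrite /y mulr0 addr0.
have q_s0 : (map_poly (meval y0) q).[s0] = 0 by apply: root_specialization sp0 q_root.
have s0_half : 0 < `|s0| / 2%:R by rewrite divr_gt0 ?normr_gt0 // ltr0n.
have [K1 K1_ge0 hK1] := poly_lipschitz0 (map_poly L q).[s0%:P].
have /boolp.choice[Kc hKc] : forall ij : 'I_n * nat, exists K, 1 <= K /\
    forall x, `|x| <= 1 -> `|(L (P ij.1)`_ij.2).[x]| <= K.
  by move=> ij; have [K ? ?] := poly_norm_bound (L (P ij.1)`_ij.2) (@ler01 C); exists K.
have /boolp.choice[Kl hKl] : forall ij : 'I_n * nat, exists K, 0 <= K /\
    forall x, `|x| <= 1 -> `|(L (P ij.1)`_ij.2).[x] - (L (P ij.1)`_ij.2).[0]| <= K * `|x|.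
  by move=> ij; have [K ? ?] := poly_lipschitz0 (L (P ij.1)`_ij.2); exists K.
(* Bounds the roots of [P i] over every point of the line with parameter of norm at most 1. *)
pose M i := 1 + \sum_(j < (size (P i)).-1) Kc (i, val j).
have M_ge0 i : 0 <= M i.
  by rewrite addr_ge0 // sumr_ge0 // => j _; rewrite (le_trans ler01) //; case: (hKc (i, val j)).
have /boolp.choice[E hE] : forall i, exists K, 1 <= K /\ forall x, `|x| <= M i -> `|(e i).[x]| <= K.
  by move=> i; have [K ? ?] := poly_norm_bound (e i) (M_ge0 i); exists K.
have E_gt0 i : 0 < E i by apply: lt_le_trans ltr01 _; case: (hE i).
have prodE_gt0 : 0 < \prod_i E i by apply: prodr_gt0.
(* The factors of [t] are bounded by the [E i] and their product will be at least half of the norm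
   of [s0]; so [delta] bounds each factor from below. *)
pose delta := `|s0| / 2%:R / \prod_i E i.
have delta_gt0 : 0 < delta by rewrite divr_gt0.
pose K2 i := \sum_(j < size (P i)) Kl (i, val j) * M i ^+ j.
have K2_ge0 i : 0 <= K2 i.
  by rewrite sumr_ge0 // => j _; rewrite mulr_ge0 ?exprn_ge0 //; case: (hKl (i, val j)).
have [d d_gt0 hd] := eventually0_and (eventually0_le1 C) (eventually0_and
  (eventually0_linear K1_ge0 (exprn_gt0 (size q).-1 s0_half))
  (eventually0_all (fun i => eventually0_linear (K2_ge0 i) (mulr_gt0 delta_gt0 (exprn_gt0 (m i) eps0))))).
have [s [s_gt0 sd LGs]] := poly_nonroot_near0 LG0 d_gt0.
have [s_le1 [s_K1 s_K2]] := hd s s_gt0 sd.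
have ns : `|s| = s by apply: gtr0_norm.
have ns1 : `|s| <= 1 by rewrite ns.
have [s1 s1_root s1_near] : exists2 s1, root (map_poly (meval (y s)) q) s1 & `|s0 - s1| < `|s0| / 2%:R.
  apply: close_root => //; first by rewrite monic_map.
  rewrite size_map_poly_id0 ?(monicP q_monic) ?rmorph1 ?oner_neq0 // -evL.
  have := hK1 s ns1; rewrite evL0 q_s0 subr0 ns => /le_lt_trans; exact.
have s1_big : `|s0| / 2%:R <= `|s1|.
  have := ler_normD (s0 - s1) s1; rewrite subrK => s0_le.
  have : `|s0| <= `|s0| / 2%:R + `|s1| by apply: le_trans s0_le _; rewrite lerD2r ltW.
  by rewrite {1}(splitr `|s0|) lerD2l.
(* The subring generated by [t] over the base is specialized first: the variable goes to [p t] in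
   [B] and to [s1] in [C]. This is consistent because every relation of [t] is a multiple of [q]. *)
pose kR : {rmorphism C -> {poly {mpoly C[r]}}} := polyC \o mpolyC r (R := C).
pose eR : {rmorphism {poly {mpoly C[r]}} -> C} := horner_eval s1 \o map_poly (meval (y s)).
pose fR : {rmorphism {poly {mpoly C[r]}} -> B} := horner_eval (p t) \o map_poly f.
have eRC a : eR a%:P = a.@[y s] by rewrite /eR /= map_polyC /horner_eval hornerC.
have fRC a : fR a%:P = f a by rewrite /fR /= map_polyC /horner_eval hornerC.
have [||c|i|z hz] := @specialize_integral C n B _ p kR eR fR.
- by move=> c; apply: etrans (eRC _) _; rewrite mevalC.
- move=> F /rootP/q_min[Q ->]; rewrite /eR /= /horner_eval rmorphM /= hornerM.
  by rewrite (rootP s1_root) mulr0.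
- by apply: etrans (fRC _) _; apply: fC.
- have [F mF rF] := int i; exists (map_poly polyC F); first exact: monic_map.
  rewrite -map_poly_comp; suff -> : map_poly (fR \o polyC) F = map_poly f F by [].
  by apply: eq_map_poly => x; apply: fRC.
have spz F : p F = 0 -> F.@[z] = 0.
  by move=> pF; rewrite -(hz 0) ?rmorph0.
have Yz i : (Y i).@[z] = y s i.
  rewrite -(hz ('X_i)%:P); first by rewrite eRC mevalXU.
  by rewrite fRC /f /= substX.
have tz : t.@[z] = s1.
  rewrite -(hz 'X); first by rewrite /eR /= map_polyX /horner_eval hornerX.
  by rewrite /fR /= map_polyX /horner_eval hornerX.
have rootz F H : root (map_poly f F) (p H) -> (map_poly (meval (y s)) F).[H.@[z]] = 0.
  move/(root_specialization spz) => <-; congr (horner _ _); apply: eq_map_poly => a.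
  by apply: meval_eq => i; rewrite Yz.
have Pz i : root (map_poly (meval (y s)) (P i)) (z i).
  by apply/rootP; have [_ /rootz] := hP i; rewrite mevalXU.
have z_le i : `|z i| <= M i.
  apply: le_trans (monic_root_bound _ (Pz i)) _; first by rewrite monic_map //; case: (hP i).
  rewrite /M lerD2l size_map_poly_id0; last first.
    by case: (hP i) => /monicP -> _; rewrite rmorph1 oner_neq0.
  by apply: ler_sum => j _; rewrite coef_map /= -LE; case: (hKc (i, val j)) => _ /(_ s ns1).
have ez i : delta <= `|(e i).[z i]|.
  rewrite /delta ler_pdivrMr // (le_trans s1_big) // -tz tE normr_prod.
  rewrite (bigD1 i) //= [\prod_i E i](bigD1 i) //= ler_wpM2l //.
  apply: (@le_trans _ _ (\prod_(j | j != i) E j)).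
    by apply: ler_prod => j _; rewrite normr_ge0; case: (hE j) => _ /(_ _ (z_le j)).
  by rewrite ler_peMl ?prodr_ge0 // => [j _|]; [exact: ltW|case: (hE i)].
exists z; split=> // [|i].
  apply/eqP => hz0; move/eqP: LGs; apply; rewrite LE.
  by have := rootz _ _ G_root; rewrite hz0 horner_coef0 coef_map.
(* [P i] taken at [y s] vanishes at [z i], so only the variation of its coefficients between [y0]
   and [y s] contributes. *)
have : `|(p0 i).[z i]| < delta * eps ^+ m i.
  apply: le_lt_trans (s_K2 i).
  have -> : (p0 i).[z i] = - \sum_(j < size (P i)) ((L (P i)`_j).[s] - (L (P i)`_j).[0]) * z i ^+ j.
    have hw (ev : {rmorphism {mpoly C[r]} -> C}) :
        (map_poly ev (P i)).[z i] = \sum_(j < size (P i)) ev (P i)`_j * z i ^+ j.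
      rewrite (@horner_coef_wide _ (size (P i))) ?size_poly //.
      by apply: eq_bigr => j _; rewrite coef_map.
    have -> : (p0 i).[z i] = - ((map_poly (meval (y s)) (P i)).[z i] - (p0 i).[z i]).
      by rewrite (rootP (Pz i)) sub0r opprK.
    rewrite /p0 !hw -sumrB; congr (- _).
    by apply: eq_bigr => j _; rewrite /= LE L0 mulrBl.
  rewrite normrN (le_trans (ler_norm_sum _ _ _)) // mulr_suml ler_sum // => j _.
  rewrite normrM normrX mulrAC ler_pM ?exprn_ge0 //.
    by have [_ /(_ s ns1)] := hKl (i, val j); rewrite ns.
  by rewrite lerXn2r ?nnegrE.
rewrite p0E hornerM horner_exp hornerXsubC normrM normrX => lt.
have e_gt0 : 0 < `|(e i).[z i]| by apply: lt_le_trans (ez i).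
have : `|z i - z0 i| ^+ m i < eps ^+ m i.
  rewrite -(ltr_pM2l e_gt0); apply: (lt_le_trans lt).
  by rewrite ler_pM2r ?exprn_gt0.
by rewrite ltr_pXn2r ?m_gt0 ?nnegrE ?(ltW eps0).
Qed.
End DenseSpecialization.

(** * Nullstellensatz and Euclidean density of locally closed sets *)

Lemma noetherian_mpoly n (F : fieldType) : noetherian {mpoly F[n]}.
Proof.
elim: n => [|n /hilbert_basis IH].
  apply: (@noetherian_surj _ _ (@mpolyC 0 F)); last exact: noetherian_field.
  by move=> G; exists G@_0%MM; apply/esym/nvar0_mpolyC.
pose h : {rmorphism {mpoly F[n.+1]} -> {mpoly F[n.+1]}} := idfun.
(* Any weights would do: only the surjectivity given by [shear_eval] matters. *)
pose w (_ : 'I_n) := 0%N.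
pose g : {rmorphism {mpoly F[n]} -> {mpoly F[n.+1]}} :=
  mmap (h \o mpolyC n.+1 (R := F)) (unshear_var w h).
pose u : {rmorphism {poly {mpoly F[n]}} -> {mpoly F[n.+1]}} := horner_eval 'X_ord0 \o map_poly g.
apply: (@noetherian_surj _ _ u) => // G.
by exists (shear w G); apply: (shear_eval w h G).
Qed.

(** A proper [J] lies in a prime ideal; by Noether normalization the origin of the base lifts to a
    point of its zero set. *)
Lemma nullstellensatz (C : numClosedFieldType) n (J : {mpoly C[n]} -> Prop) :
  is_ideal J -> (forall z, exists F, J F /\ F.@[z] != 0) -> J 1.
Proof.
move=> idJ nz; apply: boolp.contrapT => J1.
have [|||B [p [dom Jp _]]] := @separating_domain _ J (fun x => x = 1) idJ => //.
- by move=> x y -> ->; rewrite mulr1.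
- by move=> x Jx x1; apply: J1; rewrite -x1.
have [r [Y [inj int]]] := noether_normalization p.
pose f : {rmorphism {mpoly C[r]} -> B} := p \o subst Y.
pose e : {rmorphism {mpoly C[r]} -> C} := meval (fun=> 0).
pose k : {rmorphism C -> {mpoly C[r]}} := mpolyC r (R := C).
have [|||i|z hz] := @specialize_integral C n B _ p k e f.
- by move=> c; apply: mevalC.
- by move=> a /inj ->; rewrite rmorph0.
- by move=> c; rewrite /f /= substC.
- exact: int.
have [F [/Jp pF]] := nz z.
by rewrite -(hz 0) ?rmorph0 ?eqxx.
Qed.

(** Finitely many inequations [s] suffice, and [z0] is in the closure of the part of [V] cut out by
    a single [h]: otherwise the product of the polynomials [g h] separating [z0] from each part
    would vanish on [V] but not at [z0]. *)
Lemma zariski_closure_approx (C : numClosedFieldType) n (S T : {mpoly C[n]} -> Prop)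
    (V : ('I_n -> C) -> Prop) (z0 : 'I_n -> C) (eps : C) :
  (forall z, V z <-> (forall F, S F -> F.@[z] = 0) /\ exists F, T F /\ F.@[z] != 0) ->
  (forall G, (forall z, V z -> G.@[z] = 0) -> G.@[z0] = 0) -> 0 < eps ->
  exists z, V z /\ forall i, `|z i - z0 i| < eps.
Proof.
move=> VE z0V eps0; have [s [sT Ts]] := noetherian_mpoly T.
have [h [hs z0h]] : exists h, h \in s /\
    forall G, (forall z, V z -> h.@[z] != 0 -> G.@[z] = 0) -> G.@[z0] = 0.
  apply: boolp.contrapT => no.
  have /boolp.choice[g gP] : forall h, exists g, h \in s ->
      (forall z, V z -> h.@[z] != 0 -> g.@[z] = 0) /\ g.@[z0] != 0.
    move=> h; have [hs|hs] := boolP (h \in s); last by exists 0.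
    apply: boolp.contrapT => noh; apply: no; exists h; split=> // G hG.
    by apply: boolp.contrapT => /eqP G0; apply: noh; exists G.
  suff /eqP : (\prod_(h <- s) g h).@[z0] = 0.
    rewrite rmorph_prod; apply/negP; rewrite prodf_seq_neq0; apply/allP => h hs.
    by have [_] := gP h hs.
  apply: z0V => z Vz; rewrite rmorph_prod.
  have [_ [F [/Ts[c ->] Fz]]] := (VE z).1 Vz.
  have [h hs hz] : exists2 h, h \in s & h.@[z] != 0.
    apply: boolp.contrapT => noh; move/negP: Fz; apply; rewrite rmorph_sum big1 // => i _.
    rewrite rmorphM /=; suff -> : (s`_i).@[z] = 0 by rewrite mulr0.
    by apply/eqP/negPn/negP => hz; apply: noh; exists s`_i => //; apply: mem_nth.
  apply/eqP; rewrite prodf_seq_eq0; apply/hasP; exists h => //=; apply/eqP.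
by have [gV _] := gP h hs; apply: gV.
pose J (F : {mpoly C[n]}) := forall z, V z -> h.@[z] != 0 -> F.@[z] = 0.
have idJ : is_ideal J.
  split=> [z _ _|a u v Ju Jv z Vz hz]; first exact: meval0.
  by rewrite mevalD mevalM Ju // Jv // mulr0 addr0.
(* A prime ideal avoiding [M] omits [h] and consists of polynomials vanishing at [z0]. *)
pose M (F : {mpoly C[n]}) := exists k g, g.@[z0] != 0 /\ F = h ^+ k * g.
have Mg g : g.@[z0] != 0 -> M g by move=> hg; exists 0%N, g; rewrite mul1r.
have [||x Jx [k [g [gz0 xE]]]|B [p [dom Jp Mp]]] := @separating_domain _ J M idJ.
- by apply: Mg; rewrite meval1 oner_neq0.
- move=> _ _ [k [g [hg ->]]] [k' [g' [hg' ->]]]; exists (k + k')%N, (g * g').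
  by rewrite mevalM mulf_neq0 // exprD mulrACA.
- move/eqP: gz0; apply; apply: z0h => z Vz hz.
  have /eqP := Jx z Vz hz; rewrite xE mevalM rmorphXn mulf_eq0 expf_eq0 (negPf hz) andbF.
  by move/eqP.
have sp0 F : p F = 0 -> F.@[z0] = 0.
  by move=> pF; apply/eqP/negPn/negP => /Mg/Mp.
have ph : p h <> 0 by apply: Mp; exists 1%N, 1; rewrite meval1 oner_neq0 expr1 mulr1.
have [z [spz hz near]] := dense_specialization dom sp0 ph eps0.
exists z; split=> //; apply/VE; split=> [F SF|]; last by exists h; split=> //; apply: sT.
by apply/spz/Jp => y /VE[h1 _] _; apply: h1.
Qed.

(** * Continuous rational functions *)

Section Near.
Variables (C : numFieldType) (n : nat).
Implicit Types (z : 'I_n -> C) (Q : ('I_n -> C) -> Prop).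

(** Phrased with [eventually0], so that finite intersections of neighbourhoods come from its lemmas;
    [near_ptP] gives the usual form. *)
Definition near_pt z Q := eventually0 (fun d => forall y, (forall i, `|y i - z i| < d) -> Q y).

Lemma near_ptP z Q :
  near_pt z Q <-> exists2 d, 0 < d & forall y, (forall i, `|y i - z i| < d) -> Q y.
Proof.
split=> -[d d0 h]; exists d => //; first exact: h.
by move=> t t0 td y hy; apply: h => i; apply: lt_le_trans td.
Qed.

Lemma near_pt_and z Q Q' : near_pt z Q -> near_pt z Q' -> near_pt z (fun y => Q y /\ Q' y).
Proof.
move=> h h'; have [d d0 hd] := eventually0_and h h'.
by exists d => // t t0 td y hy; have [h1 h2] := hd t t0 td; split; [apply: h1|apply: h2].
Qed.

Lemma near_pt_all (I : finType) z (Q : I -> ('I_n -> C) -> Prop) :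
  (forall i, near_pt z (Q i)) -> near_pt z (fun y => forall i, Q i y).
Proof.
move=> h; have [d d0 hd] := eventually0_all h.
by exists d => // t t0 td y hy i; apply: (hd t t0 td).
Qed.

Lemma near_pt_mono z Q Q' : (forall y, Q y -> Q' y) -> near_pt z Q -> near_pt z Q'.
Proof. by move=> QQ' [d d0 hd]; exists d => // t t0 td y hy; apply: QQ'; apply: (hd t). Qed.

Lemma near_ptT z Q : (forall y, Q y) -> near_pt z Q.
Proof. by move=> h; exists 1 => // t _ _ y _; apply: h. Qed.

Lemma meval_near (G : {mpoly C[n]}) z e : 0 < e -> near_pt z (fun y => `|G.@[y] - G.@[z]| < e).
Proof.
pose P (G : {mpoly C[n]}) := forall e, 0 < e -> near_pt z (fun y => `|G.@[y] - G.@[z]| < e).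
have PC c : P c%:MP by move=> d d0; apply: near_ptT => y; rewrite !mevalC subrr normr0.
have PX i : P 'X_i.
  by move=> d d0; apply/near_ptP; exists d => // y hy; rewrite !mevalXU.
have PD F H : P F -> P H -> P (F + H).
  move=> PF PH d d0; have d2 : 0 < d / 2%:R by rewrite divr_gt0 // ltr0n.
  apply: near_pt_mono (near_pt_and (PF _ d2) (PH _ d2)) => y [h1 h2].
  rewrite !mevalD opprD addrACA (splitr d) (le_lt_trans (ler_normD _ _)) //.
  exact: ltrD.
have PM F H : P F -> P H -> P (F * H).
  move=> PF PH d d0; have d2 : 0 < d / 2%:R by rewrite divr_gt0 // ltr0n.
  pose a := `|F.@[z]| + 1; pose b := `|H.@[z]| + 1.
  have a0 : 0 < a by rewrite ltr_wpDl.
  have b0 : 0 < b by rewrite ltr_wpDl.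
  apply: near_pt_mono (near_pt_and (PF _ (divr_gt0 d2 b0))
    (near_pt_and (PH _ (divr_gt0 d2 a0)) (PH _ (@ltr01 C)))) => y [h1 [h2 h3]].
  have hb : `|H.@[y]| < b.
    rewrite /b addrC -ltrBlDr (le_lt_trans _ h3) //.
    by rewrite (le_trans _ (lerB_dist _ _)).
  have -> : (F * H).@[y] - (F * H).@[z] =
      (F.@[y] - F.@[z]) * H.@[y] + F.@[z] * (H.@[y] - H.@[z]).
    by rewrite !mevalM mulrBl mulrBr addrA subrK.
  rewrite (splitr d) (le_lt_trans (ler_normD _ _)) // !normrM ltr_leD //.
    apply: (@le_lt_trans _ _ (`|F.@[y] - F.@[z]| * b)); first by rewrite ler_wpM2l // ltW.
    by rewrite -ltr_pdivlMr.
  apply: (@le_trans _ _ (a * `|H.@[y] - H.@[z]|)); first by rewrite ler_wpM2r // lerDl.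
  by rewrite mulrC -ler_pdivlMr // ltW.
suff : P G by apply.
rewrite (mpolyE G); elim/big_ind: _ => [||m _]; [exact: (PC 0)|exact: PD|].
rewrite -mul_mpolyC; apply: (PM) => //; rewrite mpolyXE_id.
elim/big_ind: _ => [||i _]; [exact: (PC 1)|exact: PM|].
by elim: (m i) => [|k IH]; [exact: (PC 1)|rewrite exprS; apply: PM].
Qed.
End Near.

(** * Graphs of functions in affine space of one more dimension *)

Section Graph.
Variables (C : numClosedFieldType) (n : nat).

Definition graph_pt (z : 'I_n -> C) (t : C) (i : 'I_(n + 1)) : C :=
  match split i with inl j => z j | inr _ => t end.

Lemma graph_pt_l z t i : graph_pt z t (lshift 1 i) = z i.
Proof. by rewrite /graph_pt (unsplitK (inl i)). Qed.

Lemma graph_pt_r z t : graph_pt z t (rshift n ord0) = t.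
Proof. by rewrite /graph_pt (unsplitK (inr ord0)). Qed.

Lemma graph_pt_eta y : y = graph_pt (fun i => y (lshift 1 i)) (y (rshift n ord0)).
Proof.
apply: boolp.funext => i; rewrite -[i]splitK; case: (split i) => j /=; first by rewrite graph_pt_l.
by rewrite (ord1 j) graph_pt_r.
Qed.

Definition lift_mpoly : {mpoly C[n]} -> {mpoly C[n + 1]} := subst (fun i => 'X_(lshift 1 i)).
HB.instance Definition _ := GRing.RMorphism.on lift_mpoly.
Definition last_var : {mpoly C[n + 1]} := 'X_(rshift n ord0).

Lemma meval_lift_mpoly F z t : (lift_mpoly F).@[graph_pt z t] = F.@[z].
Proof. by rewrite /lift_mpoly meval_subst; apply: meval_eq => i; rewrite mevalXU graph_pt_l. Qed.

Lemma meval_last_var z t : last_var.@[graph_pt z t] = t.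
Proof. by rewrite /last_var mevalXU graph_pt_r. Qed.

Definition last_poly : {mpoly C[n + 1]} -> {poly {mpoly C[n]}} :=
  mmap (polyC \o mpolyC n (R := C))
       (fun i => match split i with inl j => ('X_j)%:P | inr _ => 'X end).
HB.instance Definition _ := GRing.RMorphism.on last_poly.

Lemma last_polyE H z t : (map_poly (meval z) (last_poly H)).[t] = H.@[graph_pt z t].
Proof.
pose g : {rmorphism _ -> _} := horner_eval t \o map_poly (meval z) \o last_poly.
apply: (@mpoly_rmorph_ext _ _ _ g) => [c|i]; rewrite /g /= /horner_eval /last_poly.
  by rewrite mmapC /= map_polyC /= hornerC !mevalC.
rewrite mmapX mmap1U mevalXU /graph_pt; case: (split i) => j.
  by rewrite map_polyC /= hornerC mevalXU.
by rewrite map_polyX hornerX.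
Qed.

Variables (X : ('I_n -> C) -> Prop) (f : ('I_n -> C) -> C).

Definition cont_on := forall z, X z -> forall e, 0 < e ->
  near_pt z (fun y => X y -> `|f y - f z| < e).

Section Rational.
Variables (SX T : {mpoly C[n]} -> Prop).
Hypothesis XE : forall z, X z <-> forall F, SX F -> F.@[z] = 0.
Definition reg_open z := X z /\ exists F, T F /\ F.@[z] != 0.
Definition fraction_of g a b :=
  forall y, X y -> g.@[y] != 0 -> b.@[y] != 0 /\ f y = a.@[y] / b.@[y].
Hypothesis dense : forall G : {mpoly C[n]},
  (forall z, reg_open z -> G.@[z] = 0) -> forall z, X z -> G.@[z] = 0.
Hypothesis reg : forall z, reg_open z -> exists g a b, fraction_of g a b /\ g.@[z] != 0.
Hypothesis cf : cont_on.

(** Zariski density of the locally closed set [reg_open] in [X] gives Euclidean density. *)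
Lemma reg_open_near z e : X z -> 0 < e -> exists y, reg_open y /\ forall i, `|y i - z i| < e.
Proof.
move=> Xz e0; apply: (@zariski_closure_approx C n SX T reg_open z e) => //.
  by move=> y; rewrite /reg_open XE.
by move=> G hG; apply: dense.
Qed.

Lemma eq0_of_small_norm (a : C) : (forall e, 0 < e -> `|a| < e) -> a = 0.
Proof.
move=> h; apply/eqP/negPn/negP => a0.
by have := h `|a|; rewrite normr_gt0 => /(_ a0); rewrite ltxx.
Qed.

(** By continuity of [f], since [reg_open] is dense for the Euclidean topology. *)
Lemma graph_identity (G : {mpoly C[n + 1]}) :
  (forall z, reg_open z -> G.@[graph_pt z (f z)] = 0) -> forall z, X z -> G.@[graph_pt z (f z)] = 0.
Proof.
move=> hG z Xz; apply: eq0_of_small_norm => e e0.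
have /near_ptP[d d0 hd] := meval_near G (graph_pt z (f z)) e0.
have nz : near_pt z (fun y => forall i, `|y i - z i| < d) by apply/near_ptP; exists d.
have /near_ptP[d' d'0 hd'] := near_pt_and nz (cf Xz d0).
have [y [Uy hy]] := reg_open_near Xz d'0.
have [yz fy] := hd' y hy.
have := hd (graph_pt y (f y)); rewrite (hG y) // sub0r normrN; apply=> i.
rewrite -[i]splitK; case: (split i) => j /=; first by rewrite !graph_pt_l.
by rewrite (ord1 j) !graph_pt_r; apply: fy; case: Uy.
Qed.

(** The point is in the Zariski closure of the graph over [reg_open], hence a Euclidean limit of
    points [(x, f x)]; continuity at [z] identifies [t]. *)
Lemma cont_graph z t : X z ->
  (forall G : {mpoly C[n + 1]}, (forall y, X y -> G.@[graph_pt y (f y)] = 0) -> G.@[graph_pt z t] = 0) ->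
  t = f z.
Proof.
move=> Xz hz.
(* Besides the equations of [X], these are [b * s = a] for all local fractions, multiplied by [g] so
   that they also hold where the fraction is not valid. *)
pose S (G : {mpoly C[n + 1]}) := (exists F, SX F /\ G = lift_mpoly F) \/
  exists g a b, fraction_of g a b /\ G = lift_mpoly g * (lift_mpoly b * last_var - lift_mpoly a).
pose T' (G : {mpoly C[n + 1]}) := exists F, T F /\ G = lift_mpoly F.
pose V (y : 'I_(n + 1) -> C) := exists x, reg_open x /\ y = graph_pt x (f x).
have VE y : V y <-> (forall G, S G -> G.@[y] = 0) /\ exists G, T' G /\ G.@[y] != 0.
  split=> [[x [[Xx [F [TF Fx]]] ->]]|].
    split; last by exists (lift_mpoly F); rewrite meval_lift_mpoly; split=> //; exists F.
    move=> _ [[G [SG ->]]|[g [a [b [fr ->]]]]]; first by rewrite meval_lift_mpoly ((XE x).1 Xx).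
    rewrite mevalM mevalB mevalM !meval_lift_mpoly meval_last_var.
    have [->|gx] := eqVneq g.@[x] 0; first by rewrite mul0r.
    by have [bx ->] := fr x Xx gx; rewrite mulrC mulrCA mulfV // mulr1 subrr mul0r.
  rewrite (graph_pt_eta y); set x := fun i => _; set s := y _ => -[hS [_ [[F [TF ->]]]]].
  rewrite meval_lift_mpoly => Fx.
  have Xx : X x by apply/XE => H SH; have := hS (lift_mpoly H); rewrite meval_lift_mpoly; apply; left; exists H.
  have Ux : reg_open x by split=> //; exists F.
  have [g [a [b [fr gx]]]] := reg Ux; have [bx fx] := fr x Xx gx.
  exists x; split=> //; congr graph_pt.
  have := hS (lift_mpoly g * (lift_mpoly b * last_var - lift_mpoly a)).
  rewrite mevalM mevalB mevalM !meval_lift_mpoly meval_last_var => h.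
  have /eqP : g.@[x] * (b.@[x] * s - a.@[x]) = 0 by apply: h; right; exists g, a, b.
  rewrite mulf_eq0 (negPf gx) /= subr_eq0 fx => /eqP <-.
  by rewrite mulrC mulKf.
have z0V G : (forall y, V y -> G.@[y] = 0) -> G.@[graph_pt z t] = 0.
  by move=> hG; apply: hz; apply: graph_identity => y Uy; apply: hG; exists y.
apply/eqP; rewrite -subr_eq0; apply/eqP/eq0_of_small_norm => e e0.
have e2 : 0 < e / 2%:R by rewrite divr_gt0 // ltr0n.
have ne : near_pt z (fun y => forall i, `|y i - z i| < e / 2%:R) by apply/near_ptP; exists (e / 2%:R).
have [d d0 hd] := near_pt_and ne (cf Xz e2).
have nz : near_pt (graph_pt z t) (fun y => (forall i, `|y (lshift 1 i) - z i| < d) /\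
    `|y (rshift n ord0) - t| < e / 2%:R).
  apply: near_pt_and; apply/near_ptP; [exists d => // | exists (e / 2%:R) => //].
    by move=> y hy i; have := hy (lshift 1 i); rewrite graph_pt_l.
  by move=> y hy; have := hy (rshift n ord0); rewrite graph_pt_r.
have /near_ptP[d' d'0 hd'] := nz.
have [_ [[x [Ux ->]] near]] := zariski_closure_approx VE z0V d'0.
have [xz xt] := hd' _ near; rewrite graph_pt_r in xt.
have [_ fx] := hd d d0 (lexx _) x (fun i => etrans (congr1 (fun u => `|u - z i| < d) (esym (graph_pt_l x (f x) i))) (xz i)).
have -> : t - f z = (f x - f z) - (f x - t) by rewrite opprB [RHS]addrC addrA subrK.
rewrite (splitr e) (le_lt_trans (ler_normB _ _)) // ltrD //.
by apply: fx; case: Ux.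
Qed.

Lemma cont_integral : exists d (a : 'I_d -> {mpoly C[n]}),
  forall z, X z -> f z ^+ d + \sum_(i < d) (a i).@[z] * f z ^+ i = 0.
Proof.
pose S (G : {mpoly C[n + 1]}) := (exists F, SX F /\ G = lift_mpoly F) \/
  exists g a b, fraction_of g a b /\ G = lift_mpoly g * (lift_mpoly a * last_var - lift_mpoly b).
pose T' (G : {mpoly C[n + 1]}) := exists F, T F /\ G = lift_mpoly F.
pose V (y : 'I_(n + 1) -> C) := exists x, [/\ reg_open x, f x != 0 & y = graph_pt x (f x)^-1].
have VE y : V y <-> (forall G, S G -> G.@[y] = 0) /\ exists G, T' G /\ G.@[y] != 0.
  split=> [[x [[Xx [F [TF Fx]]] fx0 ->]]|].
    split; last by exists (lift_mpoly F); rewrite meval_lift_mpoly; split=> //; exists F.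
    move=> _ [[G [SG ->]]|[g [a [b [fr ->]]]]]; first by rewrite meval_lift_mpoly ((XE x).1 Xx).
    rewrite mevalM mevalB mevalM !meval_lift_mpoly meval_last_var.
    have [->|gx] := eqVneq g.@[x] 0; first by rewrite mul0r.
    have [bx fx] := fr x Xx gx; move: fx0; rewrite fx mulf_eq0 invr_eq0 (negPf bx) orbF => ax.
    by rewrite invf_div mulrCA mulfV // mulr1 subrr mulr0.
  rewrite (graph_pt_eta y); set x := fun i => _; set s := y _ => -[hS [_ [[F [TF ->]]]]].
  rewrite meval_lift_mpoly => Fx.
  have Xx : X x by apply/XE => H SH; have := hS (lift_mpoly H); rewrite meval_lift_mpoly; apply; left; exists H.
  have Ux : reg_open x by split=> //; exists F.
  have [g [a [b [fr gx]]]] := reg Ux; have [bx fx] := fr x Xx gx.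
  have := hS (lift_mpoly g * (lift_mpoly a * last_var - lift_mpoly b)).
  rewrite mevalM mevalB mevalM !meval_lift_mpoly meval_last_var => h.
  have /eqP : g.@[x] * (a.@[x] * s - b.@[x]) = 0 by apply: h; right; exists g, a, b.
  rewrite mulf_eq0 (negPf gx) /= subr_eq0 => /eqP as_b.
  have a0 : a.@[x] != 0 by apply: contraNneq bx => a0; rewrite -as_b a0 mul0r.
  exists x; split=> //; first by rewrite fx mulf_neq0 // invr_eq0.
  by congr graph_pt; rewrite fx invf_div -as_b mulrC mulKf.
(* The ideal of V plus the ideal generated by the last variable. *)
pose J (G : {mpoly C[n + 1]}) := exists H : {mpoly C[n + 1]}, forall y, V y -> (G - last_var * H).@[y] = 0.
have idJ : is_ideal J.
  split; first by exists 0 => y _; rewrite mulr0 subr0 meval0.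
  move=> a u v [H hH] [H' hH']; exists (a * H + H') => y Vy.
  have -> : a * u + v - last_var * (a * H + H') = a * (u - last_var * H) + (v - last_var * H').
    by rewrite mulrBr mulrDr opprD mulrCA addrACA.
  by rewrite mevalD mevalM hH // hH' // mulr0 addr0.
(* A common zero of [J] would have last coordinate 0 and lie in the Zariski closure of [V]; nearby
   points of [V] would make [f] unbounded near [z]. *)
have [H hH] : J 1.
  apply: nullstellensatz => // y; apply: boolp.contrapT => no.
  have Jy G : J G -> G.@[y] = 0.
    by move=> JG; apply/eqP/negPn/negP => Gy; apply: no; exists G.
  have y0V G : (forall y, V y -> G.@[y] = 0) -> G.@[y] = 0.
    by move=> hG; apply: Jy; exists 0 => x Vx; rewrite mulr0 subr0 hG.
  have s0 : y (rshift n ord0) = 0.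
    by rewrite -(mevalXU y (rshift n ord0)); apply: Jy; exists 1 => x _; rewrite mulr1 subrr meval0.
  pose z i := y (lshift 1 i).
  have yE : y = graph_pt z 0 by rewrite (graph_pt_eta y) s0.
  have Xz : X z.
    apply/XE => F SF; rewrite -(meval_lift_mpoly F z 0) -yE; apply: y0V => _ [x [[Xx _] _ ->]].
    by rewrite meval_lift_mpoly; apply: (XE x).1.
  pose b := `|f z| + 1.
  have b0 : 0 < b by rewrite ltr_wpDl.
  have [d d0 hd] := cf Xz (@ltr01 C).
  have nz : near_pt (graph_pt z 0) (fun y => (forall i, `|y (lshift 1 i) - z i| < d) /\
      `|y (rshift n ord0) - 0| < b^-1).
    apply: near_pt_and; apply/near_ptP; [exists d => // | exists b^-1; rewrite ?invr_gt0 //].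
      by move=> u hu i; have := hu (lshift 1 i); rewrite graph_pt_l.
    by move=> u hu; have := hu (rshift n ord0); rewrite graph_pt_r.
  have /near_ptP[d' d'0 hd'] := nz; rewrite yE in y0V.
  have [_ [[x [[Xx _] fx0 ->]] near]] := zariski_closure_approx VE y0V d'0.
  have [xz] := hd' _ near; rewrite graph_pt_r subr0 normfV => xt.
  have fx := hd d d0 (lexx _) x (fun i => etrans (congr1 (fun u => `|u - z i| < d) (esym (graph_pt_l x (f x)^-1 i))) (xz i)) Xx.
  have : `|f x| < b.
    by rewrite /b addrC -ltrBlDr (le_lt_trans _ fx) // (le_trans _ (lerB_dist _ _)).
  move: xt; rewrite ltf_pV2 ?posrE ?normr_gt0 // => h1 h2.
  by have := lt_trans h1 h2; rewrite ltxx.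
pose L := last_poly H; pose d := size L.
(* The identity [1 = s * H] at [s = 1 / f x] is multiplied by [f x ^+ d.+1]. The power [d.+1] leaves
   a factor [f x] in every term, so the equation holds also where [f] vanishes; for [j = 0] the
   coefficient of [L] is beyond its size, hence 0. *)
exists d.+1, (fun j => - L`_(d - j)) => z Xz.
pose G := last_var ^+ d.+1 + \sum_(j < d.+1) lift_mpoly (- L`_(d - j)) * last_var ^+ j.
have GE x t : G.@[graph_pt x t] = t ^+ d.+1 + \sum_(i < d.+1) (- L`_(d - i)).@[x] * t ^+ i.
  rewrite mevalD rmorphXn rmorph_sum /= meval_last_var; congr (_ + _).
  by apply: eq_bigr => i _; rewrite rmorphM rmorphXn /= meval_lift_mpoly meval_last_var.
rewrite -GE; apply: graph_identity Xz => x Ux; rewrite GE.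
have -> : \sum_(i < d.+1) (- L`_(d - i)).@[x] * f x ^+ i = - \sum_(i < d) (L`_i).@[x] * f x ^+ (d - i).
  rewrite -sumrN (reindex_inj rev_ord_inj) /= big_ord_recr /= subSS subnn subn0.
  rewrite [L`_d]nth_default // oppr0 meval0 mul0r addr0.
  apply: eq_bigr => i _; rewrite subSS subKn ?mevalN ?mulNr //; exact: ltnW.
have [fx0|fx0] := eqVneq (f x) 0.
  rewrite fx0 expr0n /= add0r big1 ?oppr0 // => i _.
  by rewrite expr0n subn_eq0 leqNgt ltn_ord mulr0.
have := hH (graph_pt x (f x)^-1); rewrite mevalB mevalM meval1 meval_last_var => h.
have /eqP : 1 - (f x)^-1 * H.@[graph_pt x (f x)^-1] = 0 by apply: h; exists x.
rewrite subr_eq0 -last_polyE => /eqP e.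
have -> : f x ^+ d.+1 = f x ^+ d.+1 * ((f x)^-1 * (map_poly (meval x) L).[(f x)^-1]) by rewrite -e mulr1.
rewrite exprS mulrACA mulfV // mul1r mulrC.
rewrite (@horner_coef_wide _ d) ?size_poly // mulr_suml; apply/eqP; rewrite subr_eq0; apply/eqP.
apply: eq_bigr => i _; rewrite coef_map -mulrA; congr (_ * _).
by rewrite -{2}(subnK (ltnW (ltn_ord i))) exprD mulrC exprVn mulfK // expf_neq0.
Qed.
End Rational.

(** For [y] near [z], [f y] is a root of [P y], so [P z] is small at [f y]. The closed graph keeps
    [f y] away from the roots of [P z] other than [f z], which forces [f y] to be near [f z]. *)
Lemma integral_graph_cont d (a : 'I_d -> {mpoly C[n]}) (SG : {mpoly C[n + 1]} -> Prop) :
  (forall z, X z -> f z ^+ d + \sum_(i < d) (a i).@[z] * f z ^+ i = 0) ->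
  (forall z t, X z -> (forall G, SG G -> G.@[graph_pt z t] = 0) <-> t = f z) ->
  cont_on.
Proof.
move=> int gr z Xz e e0.
pose q y : {poly C} := \poly_(i < d) (if insub i is Some j then (a j).@[y] else 0).
pose P y := 'X^d + q y.
have qE y (i : 'I_d) : (q y)`_i = (a i).@[y] by rewrite coef_poly ltn_ord valK.
have sq y : (size (q y) < size ('X^d : {poly C}))%N by rewrite size_polyXn ltnS size_poly.
have Pm y : P y \is monic by rewrite monicE lead_coefDl // lead_coefXn.
have sP y : size (P y) = d.+1 by rewrite size_polyDl // size_polyXn.
have PE y t : (P y).[t] = t ^+ d + \sum_(i < d) (a i).@[y] * t ^+ i.
  rewrite hornerD hornerXn (@horner_coef_wide _ d) ?size_poly //; congr (_ + _).
  by apply: eq_bigr => i _; rewrite qE.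
have Pf y : X y -> (P y).[f y] = 0 by move=> Xy; rewrite PE int.
have [rs Pz] := closed_field_poly_normal (P z); rewrite (monicP (Pm z)) scale1r in Pz.
(* If [r] differs from [f z], some equation of the graph is nonzero at [(z, r)], hence on a
   neighbourhood, which the graph cannot meet. *)
have far r : exists2 k, 0 < k &
    near_pt z (fun y => X y -> `|f y - f z| < e \/ k <= `|f y - r|).
  have [rf|rf] := boolp.pselect (r = f z).
    exists e => //; apply: near_ptT => y _; rewrite rf.
    by case: (real_ltP (normr_real (f y - f z)) (gtr0_real e0)); [left|right].
  have [G [SGG Gr]] : exists G, SG G /\ G.@[graph_pt z r] != 0.
    apply: boolp.contrapT => no; apply: rf; apply/(gr z r Xz) => G SGG.
    by apply/eqP/negPn/negP => Gr; apply: no; exists G.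
  have G0 : 0 < `|G.@[graph_pt z r]| by rewrite normr_gt0.
  have /near_ptP[k k0 hk] := meval_near G (graph_pt z r) G0.
  exists k => //; apply/near_ptP; exists k => // y yz Xy; right.
  rewrite real_leNgt ?normr_real ?gtr0_real //; apply/negP => fr.
  have := hk (graph_pt y (f y)); rewrite ((gr y (f y) Xy).2 erefl) // sub0r normrN ltxx => h.
  suff : false by []; apply: h => i.
  rewrite -[i]splitK; case: (split i) => j /=; first by rewrite !graph_pt_l.
  by rewrite (ord1 j) !graph_pt_r.
have [k k0 hk] : exists2 k, 0 < k &
    near_pt z (fun y => X y -> `|f y - f z| < e \/ k <= `|(P z).[f y]|).
  rewrite Pz; elim: (rs) => [|r rs' [k k0 hk]].
    by exists 1 => //; apply: near_ptT => y _; right; rewrite big_nil hornerC normr1.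
  have [k' k'0 hk'] := far r; exists (k' * k); first exact: mulr_gt0.
  apply: near_pt_mono (near_pt_and hk hk') => y [h1 h2] Xy.
  have [|kr] := h2 Xy; first by left.
  have [|kp] := h1 Xy; first by left.
  by right; rewrite big_cons hornerM hornerXsubC normrM ler_pM // ltW.
pose M := 1 + \sum_(i < d) (`|(a i).@[z]| + 1).
have M1 : 1 <= M by rewrite lerDl sumr_ge0 // => i _; rewrite addr_ge0.
have M0 : 0 <= M := le_trans ler01 M1.
(* The final 1 makes [D] positive and the estimate by [k] strict. *)
pose D := \sum_(i < d) M ^+ i + 1.
have D0 : 0 < D by rewrite ltr_wpDl // sumr_ge0 // => i _; rewrite exprn_ge0.
have kD : 0 < k / D by rewrite divr_gt0.
apply: near_pt_mono (near_pt_and hk (near_pt_all (fun i =>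
  near_pt_and (meval_near (a i) z kD) (meval_near (a i) z (@ltr01 C))))) => y [h1 h2] Xy.
have [//|kp] := h1 Xy.
have fM : `|f y| <= M.
  apply: le_trans (monic_root_bound (Pm y) (introT rootP (Pf y Xy))) _.
  rewrite sP /M lerD2l ler_sum // => i _; rewrite coefD coefXn ltn_eqF // add0r qE.
  have [_ h] := h2 i; rewrite addrC -lerBlDr.
  exact: le_trans (lerB_dist _ _) (ltW h).
have : `|(P z).[f y]| < k.
  have -> : (P z).[f y] = - \sum_(i < d) ((a i).@[y] - (a i).@[z]) * f y ^+ i.
    rewrite -[LHS]subr0 -[X in _ - X](Pf y Xy) !PE opprD addrACA subrr add0r -opprB -sumrB.
    by congr (- _); apply: eq_bigr => i _; rewrite mulrBl.
  rewrite normrN (le_lt_trans (ler_norm_sum _ _ _)) //.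
  apply: (@le_lt_trans _ _ (k / D * \sum_(i < d) M ^+ i)).
    rewrite mulr_sumr ler_sum // => i _; rewrite normrM normrX ler_pM ?exprn_ge0 //.
      by have [h _] := h2 i; apply: ltW.
    by rewrite lerXn2r ?nnegrE.
  by rewrite mulrAC ltr_pdivrMr // ltr_pM2l // ltrDl.
by move/(le_lt_trans kp); rewrite ltxx.
Qed.
End Graph.

End AffineGeometry.

From mathcomp Require Import all_classical reals topology normedtype.

Import Order.TTheory GRing.Theory Num.Theory numFieldNormedType.Exports.
Import AffineGeometry.
Local Open Scope classical_set_scope.
Local Open Scope ring_scope.

(** * Continuity and coordinates *)

Section EpsDelta.
Variables (C : numClosedFieldType) (n : nat) (X : set 'rV[C]_n).

(** Neighbourhoods in the subtype are induced by those of the ambient space, whose balls are defined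
    coordinatewise. *)
Lemma nbhs_set_typeP (x : X) (P : set X) :
  nbhs x P <-> exists2 d : C, 0 < d &
    forall y : X, (forall i, `|val y ord0 i - val x ord0 i| < d) -> P y.
Proof.
split.
  case=> _ /= [] [W oW <-] /= Wx sWP.
  have /nbhs_ballP[d /= d0 dW] : nbhs (val x) W by apply: open_nbhs_nbhs.
  exists d => // y hy; apply: sWP; apply: dW; split=> // i j.
  by rewrite (ord1 i) /ball /= distrC; apply: hy.
move=> [d d0 hd]; have hb : nbhs (val x) (ball (val x) d) by apply/nbhs_ballP; exists d.
exists (val @^-1` (ball (val x) d)^°); split=> /=; [by exists (ball (val x) d)^°; first exact: open_interior|exact: hb|].
move=> y /= /interior_subset[_ by_].
by apply: hd => i; have := by_ ord0 i; rewrite /ball /= distrC.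
Qed.

Lemma continuous_epsP (f : X -> C) : continuous f <->
  forall (x : X) (e : C), 0 < e -> exists2 d : C, 0 < d &
    forall y : X, (forall i, `|val y ord0 i - val x ord0 i| < d) -> `|f y - f x| < e.
Proof.
split=> [cf x e e0|h x].
  have hb : nbhs (f x) (ball (f x) e) by apply/nbhs_ballP; exists e.
  have : nbhs x (f @^-1` ball (f x) e) by apply: cf.
  move=> /nbhs_set_typeP[d d0 hd].
  by exists d => // y /hd; rewrite /= /ball /= distrC.
move=> A /nbhs_ballP[e /= e0 eA]; apply/nbhs_set_typeP.
have [d d0 hd] := h x e e0; exists d => // y /hd hy; apply: eA.
by rewrite /ball /= distrC.
Qed.
End EpsDelta.

(** * Passage from points of [X] to coordinate functions *)

Section Coordinates.
Variables (R : realType) (n : nat) (X : set 'rV[Cplx R]_n) (f : X -> Cplx R).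
Local Notation C := (Cplx R).

Definition coords (x : X) (i : 'I_n) : C := val x ord0 i.
Definition in_coords (z : 'I_n -> C) : Prop := X (\row_i z i).
Definition of_coords z (h : in_coords z) : X :=
  SigSub (mem_set (h : X (\row_i z i))).

Definition fun_coords (z : 'I_n -> C) : C :=
  if pselect (in_coords z) is left h then f (of_coords h) else 0.

Lemma coords_in (x : X) : in_coords (coords x).
Proof.
rewrite /in_coords (_ : \row_i _ = val x); first exact: set_valP.
by apply/rowP => i; rewrite mxE.
Qed.

Lemma in_coordsP z : in_coords z -> exists x : X, z = coords x.
Proof.
move=> h; exists (of_coords h).
by apply: funext => i; rewrite /coords /= mxE.
Qed.

Lemma fun_coordsE (x : X) : fun_coords (coords x) = f x.
Proof.
rewrite /fun_coords; case: pselect => [h|/(_ (coords_in x))//]; congr f.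
by apply: val_inj; apply/rowP => i; rewrite /= mxE.
Qed.

Lemma pevalE (F : polyring R n) (x : X) : peval F (val x) = mpoly.meval (coords x) F.
Proof. by []. Qed.

Lemma peval_graph (G : polyring R (n + 1)) (x : X) t :
  peval G (row_mx (val x) t%:M) = mpoly.meval (graph_pt (coords x) t) G.
Proof.
apply: mpoly.meval_eq => i; rewrite [LHS](congr1 (fun g => g i) (graph_pt_eta _)).
by congr (graph_pt _ _ i); [apply: funext => j; rewrite row_mxEl|rewrite row_mxEr mxE eqxx].
Qed.

Lemma cont_coordsP : cont_on in_coords fun_coords <-> continuous f.
Proof.
split=> [h|/continuous_epsP h].
  apply/continuous_epsP => x e e0.
  have /near_ptP[d d0 hd] := h _ (coords_in x) e e0.
  by exists d => // y hy; have := hd (coords y) hy (coords_in y); rewrite !fun_coordsE.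
move=> _ /in_coordsP[x ->] e e0; apply/near_ptP.
have [d d0 hd] := h x e e0; exists d => // z hz /in_coordsP[y yE].
by rewrite yE !fun_coordsE; apply: hd => i; have := hz i; rewrite yE.
Qed.

Hypothesis fr : rational_fun f.

(** [T] consists of equations of the complement of the dense open set; [g] is an equation of the
    complement of a neighbourhood on which [f] is a fraction. *)
Lemma rational_coords : exists T : polyring R n -> Prop,
  (forall G, (forall z, reg_open in_coords T z -> mpoly.meval z G = 0) ->
     forall z, in_coords z -> mpoly.meval z G = 0) /\
  forall z, reg_open in_coords T z ->
    exists g a b, fraction_of in_coords fun_coords g a b /\ mpoly.meval z g != 0.
Proof.
have [U [[T UE] dU rU]] := fr.
have UP x : U x <-> reg_open in_coords T (coords x).
  split=> [Ux|[_ [F [TF Fx]]]].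
    split; first exact: coords_in.
    apply: contrapT => no; have : (~` U) x; last by apply.
    rewrite UE => F TF; apply: contrapT => /eqP Fx; apply: no; exists F; split=> //.
  apply: contrapT => nUx; have : (~` U) x by [].
  rewrite UE => /(_ F TF); rewrite pevalE => F0; by rewrite F0 eqxx in Fx.
exists T; split=> [G hG _ /in_coordsP[x ->]|_ /[dup] [[/in_coordsP[x ->] _]] /UP Ux].
  have := dU [set y : X | zeros [set G] (val y)]; move=> h.
  have : [set y : X | zeros [set G] (val y)] x; last by move=> /(_ G erefl).
  rewrite h //; first by exists [set G].
  by move=> y /UP Uy _ ->; rewrite pevalE; apply: hG.
have [V [[S VE] Vx _ [a [b [[pa aE] [pb bE] hab]]]]] := rU x Ux.
have [g [Sg gx]] : exists g, S g /\ mpoly.meval (coords x) g != 0.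
  apply: contrapT => no; have : (~` V) x; last by apply.
  rewrite VE => F SF; apply: contrapT => /eqP Fx; apply: no; exists F; split=> //.
exists g, pa, pb; split=> // _ /in_coordsP[y ->] gy.
have Vy : V y.
  apply: contrapT => nV; have : (~` V) y by [].
  by rewrite VE => /(_ g Sg); rewrite pevalE => g0; rewrite g0 eqxx in gy.
have [by0 fy] := hab y Vy.
by rewrite fun_coordsE fy aE bE -!pevalE; split=> //; rewrite -bE.
Qed.
End Coordinates.

Theorem mainTheorem3 (R : realType) (n : nat) (X : set 'rV[Cplx R]_n)
    (hX : affine_variety X) (f : X -> Cplx R) :
  K0 X f <->
  [/\ rational_fun f, integral_fun f & zclosed (graph_fun f)].
Proof.
have [S XS] := hX.
have XE z : in_coords X z <-> forall F, S F -> mpoly.meval z F = 0.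
  rewrite /in_coords [X in X (\row_i _)]XS.
  have e F : peval F (\row_i z i) = mpoly.meval z F by apply: mpoly.meval_eq => i; rewrite mxE.
  by split=> h F SF; have := h F SF; rewrite e.
split=> [[fr /cont_coordsP cf]|[fr [d [a [aP ai]]] [SG SGE]]].
  have [T [dense reg]] := rational_coords fr.
  split=> //.
    have [d [a ai]] := cont_integral XE dense reg cf.
    exists d, (fun i x => peval (a i) (val x)); split=> [i|x]; first by exists (a i).
    by have := ai _ (coords_in x); rewrite fun_coordsE.
  (* All polynomials vanishing on the graph: closedness says that they have no further zero over
     [X]. *)
  exists [set G | forall x : X, mpoly.meval (graph_pt (coords x) (f x)) G = 0].
  apply/seteqP; split=> v /= => [[x vE] G hG|hv]; first by rewrite vE peval_graph; apply: hG.
  pose z i := val v ord0 (lshift 1 i); pose t := val v ord0 (rshift n ord0).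
  have zE : \row_i z i = lsubmx (val v) by apply/rowP => i; rewrite !mxE.
  have Xz : in_coords X z by rewrite /in_coords zE; apply: (set_valP v).
  have tE : t = fun_coords f z.
    apply: (cont_graph XE dense reg cf Xz) => G hG.
    have <- : peval G (val v) = mpoly.meval (graph_pt z t) G.
      by apply: mpoly.meval_eq => i; rewrite [LHS](congr1 (fun g => g i) (graph_pt_eta _)).
    by apply: hv => x; rewrite -(fun_coordsE f x); apply: hG; apply: coords_in.
  have [x zx] := in_coordsP Xz; exists x.
  rewrite -[LHS]hsubmxK -zE; congr row_mx.
    by apply/rowP => i; rewrite mxE zx.
  apply/rowP => i; rewrite (ord1 i) !mxE -/t tE zx fun_coordsE.
  by rewrite eqxx mulr1n.
split=> //; apply/cont_coordsP.
have /choice[p pE] := aP.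
have fint z : in_coords X z ->
    fun_coords f z ^+ d + \sum_(i < d) mpoly.meval z (p i) * fun_coords f z ^+ i = 0.
  move=> /in_coordsP[x ->]; rewrite fun_coordsE -[RHS](ai x); congr (_ + _).
  by apply: eq_bigr => i _; rewrite pE.
apply: (@integral_graph_cont (Cplx R) n _ _ d p SG fint) => _ t /in_coordsP[x ->].
rewrite fun_coordsE.
have Xv : prodA1 X (row_mx (val x) t%:M).
  by rewrite /prodA1 /= row_mxKl; apply: set_valP.
pose v : prodA1 X := SigSub (mem_set Xv).
have -> : (forall G, SG G -> mpoly.meval (graph_pt (coords x) t) G = 0) <-> zeros SG (val v).
  by split=> h G SGG; have := h G SGG; rewrite peval_graph.
have -> : zeros SG (val v) <-> graph_fun f v by rewrite SGE.
split=> [[y /eq_row_mx[/val_inj <- /matrixP/(_ ord0 ord0)]]|e]; last by exists x; rewrite /= e.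
by rewrite !mxE eqxx !mulr1n.
Qed.
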